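(* Let $k$ be a field with a nonarchimedean absolute value $v:k\to\mathbb{R}_{\geq0}$, let $X=\operatorname{Spec}R$ be an affine $k$-scheme, and let $\iota:X\to T$ be a $k$-linear closed immersion into an affine $k$-scheme of the form $T=\operatorname{Spec}k[A]$ for some commutative monoid $A$. Let $\mathbf k=k^{\mathrm{mon}}$, let $\mathbf v:\mathbf k\to\mathbf T$ be the morphism of ordered blueprints given by $v$, let $B$ be the ordered blueprint associated with $\iota$ and $Y=\operatorname{Spec}B$. (All notions are defined in the context.) Then there are canonical isomorphisms $$\operatorname{Bend}_{v,\iota}(X)^{\mathrm{pos}}\;\stackrel{\sim}{\longrightarrow}\;\operatorname{Trop}_{\mathbf v}(Y)^{\mathrm{idem}}\qquad\text{and}\qquad\operatorname{Bend}_{v,\iota}(X)\;\stackrel{\sim}{\longrightarrow}\;\big(\operatorname{Trop}_{\mathbf v}(Y)^{\mathrm{idem}}\big)^{\mathrm{core}}.$$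
   Context: All rings, semirings and monoids are commutative; semirings have $0$ and $1$. Ordered blueprints. An ordered blueprint is a triple $B=(B^\bullet,B^+,\leq)$ where $B^+$ is a semiring, $B^\bullet\subset B^+$ is a multiplicatively closed subset containing $0,1$ that generates $B^+$ as a semiring, and $\leq$ is a partial order on $B^+$ that is additive and multiplicative ($x\leq y$ implies $x+z\leq y+z$ and $xz\leq yz$). The order is generated by a set of relations if it is the smallest additive and multiplicative partial order containing them. A morphism $B\to C$ is a multiplicative map $B^\bullet\to C^\bullet$ preserving $0$ and $1$ that extends (necessarily uniquely) to an order-preserving semiring homomorphism $B^+\to C^+$. The tensor product $C\otimes_BD$ is the pushout of $C\leftarrow B\to D$ in the category of ordered blueprints. $\operatorname{Spec}B$ denotes the object of the opposite category corresponding to $B$. Quotients: for a set $S$ of relations $x_i\leq y_i$ on $B^+$, let $\leq'$ be the smallest additive and multiplicative preorder on $B^+$ containing the order of $B$ and $S$, and write $x\equiv y$ if $x\leq'y$ and $y\leq'x$. Then $B/\!\!/\langle S\rangle$ has ambient semiring $B^+/\!\equiv$, the partial order induced by $\leq'$, and underlying monoid the image of $B^\bullet$. A relation $x\equiv y$ in $S$ stands for $x\leq y$ and $y\leq x$. For an ordered blueprint $B$: $B^{\mathrm{idem}}=B/\!\!/\langle1+1\equiv1\rangle$, $B^{\mathrm{pos}}=B/\!\!/\langle0\leq1\rangle$, and $B^{\mathrm{core}}=(B^\bullet,B^+,=)$ with the trivial partial order. For $Z=\operatorname{Spec}B$, $Z^{\mathrm{idem}}=\operatorname{Spec}(B^{\mathrm{idem}})$,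 $Z^{\mathrm{pos}}=\operatorname{Spec}(B^{\mathrm{pos}})$, $Z^{\mathrm{core}}=\operatorname{Spec}(B^{\mathrm{core}})$. For a monoid with zero $M$ let $M^+$ be the semiring $\mathbb{N}[M]$ of finite formal sums of elements of $M$, modulo identifying $0\in M$ with the empty sum. For a ring $R$ with multiplicative monoid $R^\bullet$, $R^{\mathrm{mon}}=(R^\bullet,(R^\bullet)^+,\leq)$ with $\leq$ generated by the relations $c\leq a+b$ for $a,b,c\in R$ with $c=a+b$ in $R$. The tropical hyperfield is the ordered blueprint $\mathbf T$ with $\mathbf T^\bullet=(\mathbb{R}_{\geq0},\cdot)$, $\mathbf T^+=\mathbb{N}[\mathbb{R}_{>0}]=(\mathbf T^\bullet)^+$ and $\leq$ generated by the relations $c\leq a+b$ for all $a,b,c\in\mathbb{R}_{\geq0}$ such that the maximum among $a,b,c$ occurs (at least) twice. A nonarchimedean absolute value is a map $v:k\to\mathbb{R}_{\geq0}$ with $v(0)=0$, $v(1)=1$, $v(ab)=v(a)v(b)$, $v(a+b)\leq\max\{v(a),v(b)\}$; viewed as a map $\mathbf k^\bullet\to\mathbf T^\bullet$, it is a morphism $\mathbf v:\mathbf k\to\mathbf T$. $\iota^\sharp:k[A]\to R$ is the surjection corresponding to $\iota$ and $I=\ker\iota^\sharp$. The ordered blueprint $B$ associated with $\iota$: $B^\bullet=\{\iota^\sharp(ca)\mid c\in k,a\in A\}$ as a submonoid of $R$; $B^+=(B^\bullet)^+$; and $\leq$ is generated by all relations $\iota^\sharp(c_aa)\leq\sum_j\iota^\sharp(c_jb_j)$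 (finite formal sums, with $c_a,c_j\in k$, $a,b_j\in A$) for which $\iota^\sharp(c_aa)=\sum_j\iota^\sharp(c_jb_j)$ in $R$. It receives a morphism from $\mathbf k$ via $c\mapsto\iota^\sharp(c1)$. $\operatorname{Trop}_{\mathbf v}(Y)=\operatorname{Spec}(B\otimes_{\mathbf k}\mathbf T)$, the tensor product being taken along $\mathbf v$. The tropical semifield $\overline{\mathbb{R}}$ is the set $\mathbb{R}_{\geq0}$ with the usual multiplication and addition $a+b=\max\{a,b\}$; $\overline{\mathbb{R}}[A]$ is the monoid semiring. $\operatorname{Bend}^{GG}_{v,\iota}(R)$ is the quotient of $\overline{\mathbb{R}}[A]$ by the semiring congruence generated by the relations $v(c_a)a+\sum_jv(c_j)b_j\sim\sum_jv(c_j)b_j$ for all $c_a,c_j\in k$, $a,b_j\in A$ (finite sums) with $c_aa-\sum_jc_jb_j\in I$. The bend of $R$ is the ordered blueprint $\operatorname{Bend}_{v,\iota}(R)$ with ambient semiring $\operatorname{Bend}^{GG}_{v,\iota}(R)$, underlying monoid the set of classes $[ta]$ with $t\in\overline{\mathbb{R}}$, $a\in A$, and trivial partial order; $\operatorname{Bend}_{v,\iota}(X)=\operatorname{Spec}\operatorname{Bend}_{v,\iota}(R)$. *)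

(* Defs.v *)
From HB Require Import structures.
From mathcomp Require Import all_boot all_order all_algebra finmap.
From mathcomp Require Import interval_inference lra boolp reals.

Set Implicit Arguments.
Unset Strict Implicit.
Unset Printing Implicit Defensive.

Import Order.TTheory GRing.Theory Num.Theory.

Local Open Scope ring_scope.

HB.mixin Record Monoid_isCommutative M of monoid.Monoid M := {
  mulmC : commutative (@monoid.mul M)
}.

#[short(type="comMonoidType")]
HB.structure Definition ComMonoid :=
  {M of Monoid_isCommutative M & monoid.Monoid M}.

HB.mixin Record ComMonoid_hasZero M of ComMonoid M := {
  zerom : M;
  mul0m : left_zero zerom (@monoid.mul M)
}.

#[short(type="comMonoid0Type")]
HB.structure Definition ComMonoid0 :=
  {M of ComMonoid_hasZero M & ComMonoid M}.

Definition mulmon (S : Type) : Type := S.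

Section MulMon.
Variable S : comPzSemiRingType.

HB.instance Definition _ := Choice.copy (mulmon S) S.
HB.instance Definition _ :=
  isSemigroup.Build (mulmon S) (@mulrA S).
HB.instance Definition _ :=
  Semigroup_isMonoid.Build (mulmon S) (@mul1r S) (@mulr1 S).
HB.instance Definition _ := Monoid_isCommutative.Build (mulmon S) (@mulrC S).
HB.instance Definition _ := ComMonoid_hasZero.Build (mulmon S) (@mul0r S).

End MulMon.

(* The monoid semiring S[A]: finitely supported functions A -> S. *)
Definition monsr (S : comPzSemiRingType) (A : comMonoidType) : Type :=
  {fsfun A -> S with 0}.

HB.instance Definition _ S A := Choice.on (monsr S A).

Section MonSR.
Variables (S : comPzSemiRingType) (A : comMonoidType).
Implicit Types (f g h : monsr S A) (a b : A) (c d : S).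

Definition monsr_zero : monsr S A := [fsfun].
Definition monsr_add f g : monsr S A :=
  [fsfun a in (finsupp f `|` finsupp g)%fset => f a + g a].

Lemma monsr_addE f g a : monsr_add f g a = f a + g a.
Proof.
rewrite /monsr_add fsfun_fun inE; case: ifPn => // /norP[fa ga].
by rewrite !fsfun_dflt // addr0.
Qed.

Lemma monsr_addA : associative monsr_add.
Proof. by move=> f g h; apply/fsfunP => a; rewrite !monsr_addE addrA. Qed.

Lemma monsr_addC : commutative monsr_add.
Proof. by move=> f g; apply/fsfunP => a; rewrite !monsr_addE addrC. Qed.

Lemma monsr_add0 : left_id monsr_zero monsr_add.
Proof. by move=> f; apply/fsfunP => a; rewrite monsr_addE fsfun0E add0r. Qed.

HB.instance Definition _ := GRing.isNmodule.Build (monsr S A)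
  monsr_addA monsr_addC monsr_add0.

Lemma monsrD f g a : (f + g) a = f a + g a.
Proof. exact: monsr_addE. Qed.

Lemma monsr0 a : (0 : monsr S A) a = 0.
Proof. by rewrite fsfun0E. Qed.

Definition mono c a : monsr S A := [fsfun x in [fset a]%fset => c].

Lemma monoE c a b : mono c a b = if b == a then c else 0.
Proof. by rewrite /mono fsfun_fun inE. Qed.

Lemma mono0 a : mono 0 a = 0.
Proof. by apply/fsfunP => b; rewrite monoE fsfun0E if_same. Qed.

Lemma monoD c d a : mono (c + d) a = mono c a + mono d a.
Proof.
by apply/fsfunP => b; rewrite monsrD !monoE; case: ifP; rewrite ?addr0.
Qed.

Definition mext (E : nmodType) (h : S -> A -> E) f : E :=
  \sum_(a <- finsupp f) h (f a) a.

Section Mext.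
Variables (E : nmodType) (h : S -> A -> E).
Hypotheses (h0 : forall a, h 0 a = 0)
  (hD : forall c d a, h (c + d) a = h c a + h d a).

Lemma mext_sub f (X : {fset A}) :
  (finsupp f `<=` X)%fset -> mext h f = \sum_(a <- X) h (f a) a.
Proof.
move=> fX; apply: big_fset_incl => // a _ /fsfun_dflt ->; exact: h0.
Qed.

Lemma mext0 : mext h 0 = 0.
Proof. by rewrite /mext finsupp0 big_seq_fset0. Qed.

Lemma mextD f g : mext h (f + g) = mext h f + mext h g.
Proof.
pose X := (finsupp f `|` finsupp g)%fset.
have fgX : (finsupp (f + g)%R `<=` X)%fset.
  apply/fsubsetP => a; rewrite mem_finsupp monsrD; apply: contraNT.
  by rewrite inE => /norP[fa ga]; rewrite !fsfun_dflt // addr0.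
rewrite (mext_sub fgX) (mext_sub (fsubsetUl _ _ : finsupp f `<=` X)%fset).
rewrite (mext_sub (fsubsetUr _ _ : finsupp g `<=` X)%fset) -big_split /=.
by apply: eq_bigr => a _; rewrite monsrD hD.
Qed.

Lemma mext_mono c a : mext h (mono c a) = h c a.
Proof.
rewrite (@mext_sub _ [fset a]%fset); last first.
  apply/fsubsetP => b; rewrite mem_finsupp monoE inE.
  by case: (b == a) => //; rewrite eqxx.
by rewrite big_seq_fset1 monoE eqxx.
Qed.

End Mext.

Lemma mono_decomp f : f = \sum_(a <- finsupp f) mono (f a) a.
Proof.
apply/fsfunP => b.
have ev (s : seq A) :
    (\sum_(a <- s) mono (f a) a : monsr S A) b = \sum_(a <- s) mono (f a) a b.
  by elim: s => [|a s IH]; rewrite ?big_nil ?big_cons ?monsr0 // monsrD IH.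
rewrite ev; case: (finsuppP f b) => [nb|fb].
  rewrite big1_seq // => a /andP[_ fa]; rewrite monoE.
  by case: eqP nb => // ->; rewrite fa.
rewrite (big_fsetD1 b) //= monoE eqxx big1_seq ?addr0 // => a /andP[_].
by rewrite !inE monoE eq_sym => /andP[/negPf ->].
Qed.

Lemma monsr_ind (P : monsr S A -> Prop) :
  P 0 -> (forall f g, P f -> P g -> P (f + g)) ->
  (forall c a, P (mono c a)) -> forall f, P f.
Proof.
move=> P0 PD Pm f; rewrite (mono_decomp f).
by elim: (X in \sum_(a <- X) _) => [|a s IH]; rewrite ?big_nil ?big_cons //; apply: PD.
Qed.

Definition monsr_one : monsr S A := mono 1 1%g.
Definition monsr_mul f g : monsr S A :=
  mext (fun c a => mext (fun d b => mono (c * d) (a * b)%g) g) f.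

Let in0 c a b : mono (c * 0) (a * b)%g = 0. Proof. by rewrite mulr0 mono0. Qed.
Let inD c a d e b :
  mono (c * (d + e)) (a * b)%g = mono (c * d) (a * b)%g + mono (c * e) (a * b)%g.
Proof. by rewrite mulrDr monoD. Qed.
Let out0 g a : mext (fun d b => mono (0 * d) (a * b)%g) g = 0.
Proof. by rewrite /mext big1 // => b _; rewrite mul0r mono0. Qed.
Let outD g c e a : mext (fun d b => mono ((c + e) * d) (a * b)%g) g =
  mext (fun d b => mono (c * d) (a * b)%g) g +
  mext (fun d b => mono (e * d) (a * b)%g) g.
Proof.
by rewrite /mext -big_split /=; apply: eq_bigr => b _; rewrite mulrDl monoD.
Qed.

Lemma monsr_mul0r : left_zero 0 monsr_mul.
Proof. by move=> g; rewrite /monsr_mul mext0. Qed.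

Lemma monsr_mulDl : left_distributive monsr_mul +%R.
Proof. by move=> f g h; rewrite /monsr_mul mextD. Qed.

Lemma monsr_mulr0 : right_zero 0 monsr_mul.
Proof.
move=> f; rewrite /monsr_mul /mext big1 // => a _.
by rewrite finsupp0 big_seq_fset0.
Qed.

Lemma monsr_mulDr : right_distributive monsr_mul +%R.
Proof.
move=> f g h; rewrite /monsr_mul [in RHS]/mext -big_split /=.
by apply: eq_bigr => a _; rewrite mextD.
Qed.

Lemma monsr_mulmm c a d b :
  monsr_mul (mono c a) (mono d b) = mono (c * d) (a * b)%g.
Proof. by rewrite /monsr_mul mext_mono // mext_mono. Qed.

Lemma monsr_mulC : commutative monsr_mul.
Proof.
move=> f g; elim/monsr_ind: f => [|f f' IH IH'|c a].
- by rewrite monsr_mul0r monsr_mulr0.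
- by rewrite monsr_mulDl monsr_mulDr IH IH'.
elim/monsr_ind: g => [|g g' IH IH'|d b].
- by rewrite monsr_mul0r monsr_mulr0.
- by rewrite monsr_mulDl monsr_mulDr IH IH'.
by rewrite !monsr_mulmm mulrC mulmC.
Qed.

Lemma monsr_mul1r : left_id monsr_one monsr_mul.
Proof.
move=> f; elim/monsr_ind: f => [|f f' IH IH'|c a].
- by rewrite monsr_mulr0.
- by rewrite monsr_mulDr IH IH'.
by rewrite monsr_mulmm mul1r mul1g.
Qed.

Lemma monsr_mulA : associative monsr_mul.
Proof.
move=> f g h; elim/monsr_ind: f => [|f f' IH IH'|c a].
- by rewrite !monsr_mul0r.
- by rewrite !monsr_mulDl IH IH'.
elim/monsr_ind: g => [|g g' IH IH'|d b].
- by rewrite monsr_mul0r !monsr_mulr0 monsr_mul0r.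
- by rewrite !monsr_mulDl !monsr_mulDr !monsr_mulDl IH IH'.
elim/monsr_ind: h => [|h h' IH IH'|e x].
- by rewrite !monsr_mulr0.
- by rewrite !monsr_mulDr IH IH'.
by rewrite !monsr_mulmm mulrA mulgA.
Qed.

HB.instance Definition _ := GRing.Nmodule_isComPzSemiRing.Build (monsr S A)
  monsr_mulA monsr_mulC monsr_mul1r monsr_mulDl monsr_mul0r.

Lemma monoM c d a b : mono c a * mono d b = mono (c * d) (a * b)%g.
Proof. exact: monsr_mulmm. Qed.

Lemma mono1 : mono 1 1%g = 1. Proof. by []. Qed.

End MonSR.

Lemma monoS (A : comMonoidType) n (a : A) :
  mono n.+1 a = mono 1%N a + mono n a.
Proof. exact: (@monoD nat A 1%N n a). Qed.

HB.instance Definition _ (S : comPzRingType) (A : comMonoidType) :=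
  GRing.ComPzSemiRing.on (monsr S A).

Section MonRing.
Variables (S : comPzRingType) (A : comMonoidType).

Definition monsr_opp (f : monsr S A) : monsr S A :=
  mext (fun c a => mono (- c) a) f.

Lemma monsr_addN : left_inverse 0 monsr_opp +%R.
Proof.
rewrite /monsr_opp.
move=> f; elim/monsr_ind: f => [|f g IHf IHg|c a].
- by rewrite mext0 addr0.
- rewrite mextD => [|a|c d a]; rewrite ?oppr0 ?mono0 ?opprD ?monoD //.
  by rewrite addrACA IHf IHg addr0.
rewrite mext_mono => [|b]; last by rewrite oppr0 mono0.
by rewrite -monoD addNr mono0.
Qed.

HB.instance Definition _ := GRing.Nmodule_isZmodule.Build (monsr S A) monsr_addN.

End MonRing.

Section MonSRLift.
Variables (S : comPzSemiRingType) (A : comMonoidType) (E : comPzSemiRingType).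
Variables (s : {rmorphism S -> E}) (u : A -> E).
Hypotheses (u1 : u 1%g = 1) (uM : forall a b, u (a * b)%g = u a * u b).

Let h c a := s c * u a.
Let h0 a : h 0 a = 0. Proof. by rewrite /h rmorph0 mul0r. Qed.
Let hD c d a : h (c + d) a = h c a + h d a.
Proof. by rewrite /h rmorphD mulrDl. Qed.

Lemma monsr_lift : {F : {rmorphism monsr S A -> E} |
  forall c a, F (mono c a) = s c * u a}.
Proof.
pose F := mext h.
have F0 : F 0 = 0 by exact: mext0.
have FD f g : F (f + g) = F f + F g by exact: mextD.
have Fm c a : F (mono c a) = s c * u a by exact: mext_mono.
have F1 : F 1 = 1 by rewrite -mono1 Fm rmorph1 mul1r.
have FM f g : F (f * g) = F f * F g.
  elim/monsr_ind: f => [|f f' IH IH'|c a]; first by rewrite mul0r F0 mul0r.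
    by rewrite mulrDl !FD IH IH' mulrDl.
  elim/monsr_ind: g => [|g g' IH IH'|d b]; first by rewrite mulr0 F0 mulr0.
    by rewrite mulrDr !FD IH IH' mulrDr.
  by rewrite monoM !Fm rmorphM uM mulrACA.
pose m1 := GRing.isNmodMorphism.Build _ _ F (conj F0 FD).
pose m2 := GRing.isMonoidMorphism.Build _ _ F (conj F1 FM).
pose FF : {rmorphism monsr S A -> E} :=
  HB.pack F m1 m2.
by exists FF.
Qed.

End MonSRLift.

Record congruence (S : comPzSemiRingType) := Congruence {
  cong :> S -> S -> Prop;
  cong_refl : forall x, cong x x;
  cong_sym : forall x y, cong x y -> cong y x;
  cong_trans : forall x y z, cong x y -> cong y z -> cong x z;
  congD : forall x y z, cong x y -> cong (x + z) (y + z);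
  congM : forall x y z, cong x y -> cong (x * z) (y * z)
}.

Section CQuot.
Variables (S : comPzSemiRingType) (e : congruence S).
Implicit Types x y z : S.

Definition cong_rel : rel S := fun x y => `[< e x y >].

Lemma cong_rel_equiv : equiv_class_of cong_rel.
Proof.
split=> [x|x y|y x z]; first exact/asboolP/cong_refl.
  by apply/asboolP/asboolP; exact: cong_sym.
by move=> /asboolP xy /asboolP yz; apply/asboolP; exact: cong_trans xy yz.
Qed.

Canonical cong_equiv := EquivRelPack cong_rel_equiv.

Definition cquot : Type := {eq_quot cong_equiv}%qT.

HB.instance Definition _ := Choice.on cquot.
HB.instance Definition _ := Quotient.on cquot.

Definition cls x : cquot := \pi_cquot%qT x.

Lemma clsP x y : cls x = cls y <-> e x y.
Proof.
have -> : (cls x = cls y) <-> (cls x == cls y) by split=> [->//|/eqP].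
by rewrite /cls [_ == _](@eqquotE _ cong_equiv) /=; split=> /asboolP.
Qed.

Lemma cls_surj (X : cquot) : exists x, X = cls x.
Proof. by exists (repr X); rewrite /cls reprK. Qed.

Lemma repr_cls x : e (repr (cls x)) x.
Proof. by apply/clsP; rewrite /cls reprK. Qed.

Lemma congDD x x' y y' : e x x' -> e y y' -> e (x + y) (x' + y').
Proof.
move=> xx' yy'; apply: cong_trans (congD y xx') _.
by rewrite ![x' + _]addrC; exact: congD.
Qed.

Lemma congMM x x' y y' : e x x' -> e y y' -> e (x * y) (x' * y').
Proof.
move=> xx' yy'; apply: cong_trans (congM y xx') _.
by rewrite ![x' * _]mulrC; exact: congM.
Qed.

Definition cquot_add (X Y : cquot) := cls (repr X + repr Y).
Definition cquot_mul (X Y : cquot) := cls (repr X * repr Y).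

Lemma cquot_addE x y : cquot_add (cls x) (cls y) = cls (x + y).
Proof. by apply/clsP/congDD; exact: repr_cls. Qed.

Lemma cquot_mulE x y : cquot_mul (cls x) (cls y) = cls (x * y).
Proof. by apply/clsP/congMM; exact: repr_cls. Qed.

Lemma cquot_addA : associative cquot_add.
Proof.
move=> X Y Z; have [x ->] := cls_surj X; have [y ->] := cls_surj Y.
by have [z ->] := cls_surj Z; rewrite !cquot_addE addrA.
Qed.

Lemma cquot_addC : commutative cquot_add.
Proof.
move=> X Y; have [x ->] := cls_surj X; have [y ->] := cls_surj Y.
by rewrite !cquot_addE addrC.
Qed.

Lemma cquot_add0 : left_id (cls 0) cquot_add.
Proof. by move=> X; have [x ->] := cls_surj X; rewrite cquot_addE add0r. Qed.

HB.instance Definition _ :=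
  GRing.isNmodule.Build cquot cquot_addA cquot_addC cquot_add0.

Lemma cquot_mulA : associative cquot_mul.
Proof.
move=> X Y Z; have [x ->] := cls_surj X; have [y ->] := cls_surj Y.
by have [z ->] := cls_surj Z; rewrite !cquot_mulE mulrA.
Qed.

Lemma cquot_mulC : commutative cquot_mul.
Proof.
move=> X Y; have [x ->] := cls_surj X; have [y ->] := cls_surj Y.
by rewrite !cquot_mulE mulrC.
Qed.

Lemma cquot_mul1 : left_id (cls 1) cquot_mul.
Proof. by move=> X; have [x ->] := cls_surj X; rewrite cquot_mulE mul1r. Qed.

Lemma cquot_mulDl : left_distributive cquot_mul cquot_add.
Proof.
move=> X Y Z; have [x ->] := cls_surj X; have [y ->] := cls_surj Y.
by have [z ->] := cls_surj Z; rewrite !(cquot_mulE, cquot_addE) mulrDl.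
Qed.

Lemma cquot_mul0 : left_zero (cls 0) cquot_mul.
Proof. by move=> X; have [x ->] := cls_surj X; rewrite cquot_mulE mul0r. Qed.

HB.instance Definition _ := GRing.Nmodule_isComPzSemiRing.Build cquot
  cquot_mulA cquot_mulC cquot_mul1 cquot_mulDl cquot_mul0.

Lemma cls_nmod : nmod_morphism cls.
Proof. by split=> // x y; rewrite -cquot_addE. Qed.

Lemma cls_monoid : monoid_morphism cls.
Proof. by split=> // x y; rewrite -cquot_mulE. Qed.

HB.instance Definition _ := GRing.isNmodMorphism.Build S cquot cls cls_nmod.
HB.instance Definition _ := GRing.isMonoidMorphism.Build S cquot cls cls_monoid.

Lemma cquot_lift (E : comPzSemiRingType) (f : {rmorphism S -> E}) :
  (forall x y, e x y -> f x = f y) ->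
  {F : {rmorphism cquot -> E} | forall x, F (cls x) = f x}.
Proof.
move=> fe; pose F (X : cquot) := f (repr X).
have Fc x : F (cls x) = f x by apply/fe/repr_cls.
have F0 : F 0 = 0 by rewrite -[0]/(cls 0) Fc rmorph0.
have F1 : F 1 = 1 by rewrite -[1]/(cls 1) Fc rmorph1.
have FD X Y : F (X + Y) = F X + F Y.
  have [x ->] := cls_surj X; have [y ->] := cls_surj Y.
  by rewrite -rmorphD !Fc rmorphD.
have FM X Y : F (X * Y) = F X * F Y.
  have [x ->] := cls_surj X; have [y ->] := cls_surj Y.
  by rewrite -rmorphM !Fc rmorphM.
pose m1 := GRing.isNmodMorphism.Build _ _ F (conj F0 FD).
pose m2 := GRing.isMonoidMorphism.Build _ _ F (conj F1 FM).
pose FF : {rmorphism cquot -> E} := HB.pack F m1 m2.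
by exists FF.
Qed.

End CQuot.

Section Generated.
Variables (S : comPzSemiRingType) (r : S -> S -> Prop).

Inductive gencong : S -> S -> Prop :=
| gencong_in x y : r x y -> gencong x y
| gencong_refl x : gencong x x
| gencong_sym x y : gencong x y -> gencong y x
| gencong_trans x y z : gencong x y -> gencong y z -> gencong x z
| gencongD x y z : gencong x y -> gencong (x + z) (y + z)
| gencongM x y z : gencong x y -> gencong (x * z) (y * z).

Definition gen_congruence : congruence S :=
  Congruence gencong_refl gencong_sym gencong_trans gencongD gencongM.

(* The smallest additive and multiplicative preorder containing r. *)
Inductive genpre : S -> S -> Prop :=
| genpre_in x y : r x y -> genpre x y
| genpre_refl x : genpre x x
| genpre_trans x y z : genpre x y -> genpre y z -> genpre x z
| genpreD x y z : genpre x y -> genpre (x + z) (y + z)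
| genpreM x y z : genpre x y -> genpre (x * z) (y * z).

Definition symgenpre (x y : S) : Prop := genpre x y /\ genpre y x.

Definition symgenpre_congruence : congruence S.
Proof.
apply: (@Congruence S symgenpre) => [x|x y []|x y z [xy yx] [yz zy]|x y z []|x y z []].
- by split; exact: genpre_refl.
- by [].
- by split; [exact: genpre_trans xy yz | exact: genpre_trans zy yx].
- by split; exact: genpreD.
- by split; exact: genpreM.
Defined.

Definition pquot : Type := cquot symgenpre_congruence.
HB.instance Definition _ := GRing.ComPzSemiRing.on pquot.

Definition pcls : {rmorphism S -> pquot} := @cls S symgenpre_congruence.

Lemma pclsP x y : pcls x = pcls y <-> genpre x y /\ genpre y x.
Proof. exact: clsP. Qed.

Definition pquot_le (X Y : pquot) : Prop :=
  exists x y, [/\ X = pcls x, Y = pcls y & genpre x y].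

Lemma pquot_leP x y : pquot_le (pcls x) (pcls y) <-> genpre x y.
Proof.
split=> [[x' [y' [/pclsP[xx' _] /pclsP[_ y'y] x'y']]]|xy]; last by exists x, y.
exact: genpre_trans (genpre_trans xx' x'y') y'y.
Qed.

Lemma pcls_surj (X : pquot) : exists x, X = pcls x.
Proof. exact: cls_surj. Qed.

Lemma pquot_le_refl X : pquot_le X X.
Proof. by have [x ->] := pcls_surj X; apply/pquot_leP; exact: genpre_refl. Qed.

Lemma pquot_le_anti X Y : pquot_le X Y -> pquot_le Y X -> X = Y.
Proof.
have [x ->] := pcls_surj X; have [y ->] := pcls_surj Y.
by move=> /pquot_leP xy /pquot_leP yx; apply/pclsP.
Qed.

Lemma pquot_le_trans X Y Z : pquot_le X Y -> pquot_le Y Z -> pquot_le X Z.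
Proof.
have [x ->] := pcls_surj X; have [y ->] := pcls_surj Y.
have [z ->] := pcls_surj Z => /pquot_leP xy /pquot_leP yz.
by apply/pquot_leP; exact: genpre_trans xy yz.
Qed.

Lemma pquot_leD X Y Z : pquot_le X Y -> pquot_le (X + Z) (Y + Z).
Proof.
have [x ->] := pcls_surj X; have [y ->] := pcls_surj Y.
have [z ->] := pcls_surj Z => /pquot_leP xy; rewrite -!rmorphD.
by apply/pquot_leP; exact: genpreD.
Qed.

Lemma pquot_leM X Y Z : pquot_le X Y -> pquot_le (X * Z) (Y * Z).
Proof.
have [x ->] := pcls_surj X; have [y ->] := pcls_surj Y.
have [z ->] := pcls_surj Z => /pquot_leP xy; rewrite -!rmorphM.
by apply/pquot_leP; exact: genpreM.
Qed.

End Generated.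

Record ordBlueprint := OrdBlueprint {
  amb :> comPzSemiRingType;
  bmon : amb -> Prop;
  ble : amb -> amb -> Prop;
  bmon0 : bmon 0;
  bmon1 : bmon 1;
  bmonM : forall x y, bmon x -> bmon y -> bmon (x * y);
  bmon_gen : forall P : amb -> Prop, P 0 -> P 1 ->
    (forall x y, P x -> P y -> P (x + y)) ->
    (forall x y, P x -> P y -> P (x * y)) ->
    (forall x, bmon x -> P x) -> forall x, P x;
  ble_refl : forall x, ble x x;
  ble_anti : forall x y, ble x y -> ble y x -> x = y;
  ble_trans : forall x y z, ble x y -> ble y z -> ble x z;
  bleD : forall x y z, ble x y -> ble (x + z) (y + z);
  bleM : forall x y z, ble x y -> ble (x * z) (y * z)
}.

(* A morphism B -> C is recorded through its extension to ambient semirings;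
   by [obHom_ext] this is determined by the map it induces on underlying
   monoids. *)
Record obHom (B C : ordBlueprint) := ObHom {
  hom_fun :> {rmorphism B -> C};
  hom_mon : forall x, bmon x -> bmon (hom_fun x);
  hom_le : forall x y, ble x y -> ble (hom_fun x) (hom_fun y)
}.

Lemma obHom_ext (B C : ordBlueprint) (f g : obHom B C) :
  (forall x, bmon x -> f x = g x) -> f =1 g.
Proof.
move=> fg; apply: bmon_gen; rewrite ?rmorph0 ?rmorph1 //.
- by move=> x y fx fy; rewrite !rmorphD fx fy.
- by move=> x y fx fy; rewrite !rmorphM fx fy.
Qed.

Definition ob_iso (B C : ordBlueprint) (f : obHom B C) : Prop :=
  exists g : obHom C B, cancel f g /\ cancel g f.

Definition is_pushout (B C D P : ordBlueprint) (f : obHom B C) (g : obHom B D)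
    (i : obHom C P) (j : obHom D P) : Prop :=
  (forall b, i (f b) = j (g b)) /\
  forall (E : ordBlueprint) (i' : obHom C E) (j' : obHom D E),
    (forall b, i' (f b) = j' (g b)) ->
    exists2 h : obHom P E,
      (forall c, h (i c) = i' c) /\ (forall d, h (j d) = j' d) &
      forall h' : obHom P E,
        (forall c, h' (i c) = i' c) -> (forall d, h' (j d) = j' d) -> h' =1 h.

Section ObQuot.
Variables (B : ordBlueprint) (r : B -> B -> Prop).

Definition obquot_rel (x y : B) : Prop := ble x y \/ r x y.

Definition obquot_mon (X : pquot obquot_rel) : Prop :=
  exists2 x : B, bmon x & X = pcls obquot_rel x.

(* B // <r> *)
Definition obquot : ordBlueprint.
Proof.
apply: (@OrdBlueprint (pquot obquot_rel) obquot_mon (@pquot_le B obquot_rel)).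
- by exists 0; [exact: bmon0 | rewrite rmorph0].
- by exists 1; [exact: bmon1 | rewrite rmorph1].
- move=> _ _ [x mx ->] [y my ->].
  by exists (x * y); [exact: bmonM | rewrite rmorphM].
- move=> P P0 P1 PD PM Pm X; have [x ->] := pcls_surj X.
  elim/bmon_gen: x; rewrite ?rmorph0 ?rmorph1 //.
  + by move=> x y Px Py; rewrite rmorphD; exact: PD.
  + by move=> x y Px Py; rewrite rmorphM; exact: PM.
  + by move=> x mx; apply: Pm; exists x.
- exact: pquot_le_refl.
- exact: pquot_le_anti.
- exact: pquot_le_trans.
- exact: pquot_leD.
- exact: pquot_leM.
Defined.

Definition obquot_cls : obHom B obquot.
Proof.
apply: (@ObHom B obquot (pcls obquot_rel)) => [x mx|x y xy]; first by exists x.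
by apply/pquot_leP/genpre_in; left.
Defined.

End ObQuot.

Definition ob_idem (B : ordBlueprint) : ordBlueprint :=
  @obquot B (fun x y => (x = 1 + 1 /\ y = 1) \/ (x = 1 /\ y = 1 + 1)).
Definition idem_cls (B : ordBlueprint) : obHom B (ob_idem B) := obquot_cls _.

Definition ob_pos (B : ordBlueprint) : ordBlueprint :=
  @obquot B (fun x y => x = 0 /\ y = 1).
Definition pos_cls (B : ordBlueprint) : obHom B (ob_pos B) := obquot_cls _.

Definition trivob (S : comPzSemiRingType) (m : S -> Prop)
  (m0 : m 0) (m1 : m 1) (mM : forall x y, m x -> m y -> m (x * y))
  (mgen : forall P : S -> Prop, P 0 -> P 1 ->
    (forall x y, P x -> P y -> P (x + y)) ->
    (forall x y, P x -> P y -> P (x * y)) ->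
    (forall x, m x -> P x) -> forall x, P x) : ordBlueprint.
Proof.
by apply: (@OrdBlueprint S m eq m0 m1 mM mgen) => // [x y z ->|x y z ->|x y z ->].
Defined.

Definition ob_core (B : ordBlueprint) : ordBlueprint :=
  trivob (bmon0 B) (bmon1 B) (@bmonM B) (@bmon_gen B).

(* The pushout C (x)_B D, built as a quotient of N[C^+ x D^+] by the bilinearity
   relations, the relations f b (x) 1 = 1 (x) g b, and the orders of C and D.
   Its universal property is [tensor_pushout]. *)
Section Tensor.
Variables (B C D : ordBlueprint) (f : obHom B C) (g : obHom B D).

Local Notation F := (monsr nat (mulmon (C * D)%type)).

Let ptens (c : C) (d : D) : F := mono 1%N ((c, d) : mulmon (C * D)%type).

Inductive tensor_eq : F -> F -> Prop :=
| tensor_Dl c c' d : tensor_eq (ptens (c + c') d) (ptens c d + ptens c' d)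
| tensor_0l d : tensor_eq (ptens 0 d) 0
| tensor_Dr c d d' : tensor_eq (ptens c (d + d')) (ptens c d + ptens c d')
| tensor_0r c : tensor_eq (ptens c 0) 0
| tensor_bal b : tensor_eq (ptens (f b) 1) (ptens 1 (g b)).

Inductive tensor_rel : F -> F -> Prop :=
| tensor_eql x y : tensor_eq x y -> tensor_rel x y
| tensor_eqr x y : tensor_eq x y -> tensor_rel y x
| tensor_lel c c' : ble c c' -> tensor_rel (ptens c 1) (ptens c' 1)
| tensor_ler d d' : ble d d' -> tensor_rel (ptens 1 d) (ptens 1 d').

Local Notation Q := (pquot tensor_rel).

Definition tens (c : C) (d : D) : Q := pcls tensor_rel (ptens c d).

Let tens_eq x y : tensor_eq x y -> pcls tensor_rel x = pcls tensor_rel y.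
Proof.
by move=> xy; apply/pclsP; split; apply: genpre_in;
  [exact: tensor_eql | exact: tensor_eqr].
Qed.

Lemma tensDl c c' d : tens (c + c') d = tens c d + tens c' d.
Proof. by rewrite /tens (tens_eq (tensor_Dl c c' d)) rmorphD. Qed.
Lemma tens0l d : tens 0 d = 0.
Proof. by rewrite /tens (tens_eq (tensor_0l d)) rmorph0. Qed.
Lemma tensDr c d d' : tens c (d + d') = tens c d + tens c d'.
Proof. by rewrite /tens (tens_eq (tensor_Dr c d d')) rmorphD. Qed.
Lemma tens0r c : tens c 0 = 0.
Proof. by rewrite /tens (tens_eq (tensor_0r c)) rmorph0. Qed.
Lemma tens_bal b : tens (f b) 1 = tens 1 (g b).
Proof. exact: tens_eq (tensor_bal b). Qed.
Lemma tensM c c' d d' : tens (c * c') (d * d') = tens c d * tens c' d'.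
Proof. by rewrite /tens -rmorphM /ptens monoM. Qed.
Lemma tens11 : tens 1 1 = 1.
Proof. by rewrite /tens -[1 in RHS](rmorph1 (pcls tensor_rel)). Qed.

Definition tensor_mon (X : Q) : Prop :=
  exists c d, [/\ bmon c, bmon d & X = tens c d].

Lemma tensor_gen (P : Q -> Prop) : P 0 -> P 1 ->
  (forall x y, P x -> P y -> P (x + y)) ->
  (forall x y, P x -> P y -> P (x * y)) ->
  (forall x, tensor_mon x -> P x) -> forall x, P x.
Proof.
move=> P0 P1 PD PM Pm X; have [x ->] := pcls_surj X.
have Pl c : P (tens c 1).
  elim/bmon_gen: c; rewrite ?tens0l ?tens11 //.
  - by move=> x' y' *; rewrite tensDl; exact: PD.
  - by move=> x' y' *; rewrite -[1]mulr1 tensM; exact: PM.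
  - by move=> x' mx'; apply: Pm; exists x', 1; split=> //; exact: bmon1.
have Pr d : P (tens 1 d).
  elim/bmon_gen: d; rewrite ?tens0r ?tens11 //.
  - by move=> x' y' *; rewrite tensDr; exact: PD.
  - by move=> x' y' *; rewrite -[1]mulr1 tensM; exact: PM.
  - by move=> x' mx'; apply: Pm; exists 1, x'; split=> //; exact: bmon1.
elim/monsr_ind: x => [|x y Px Py|n [c d]]; first by rewrite rmorph0.
  by rewrite rmorphD; exact: PD.
elim: n => [|n IH]; first by rewrite mono0 rmorph0.
rewrite monoS rmorphD; apply: PD => //.
rewrite -[pcls _ _]/(tens c d) -[c]mulr1 -[d]mul1r tensM; exact: PM.
Qed.

Definition tensor : ordBlueprint.
Proof.
apply: (@OrdBlueprint Q tensor_mon (@pquot_le _ tensor_rel)).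
- by exists 0, 0; split; rewrite ?tens0l //; exact: bmon0.
- by exists 1, 1; split; rewrite ?tens11 //; exact: bmon1.
- move=> _ _ [c [d [mc md ->]]] [c' [d' [mc' md' ->]]].
  by exists (c * c'), (d * d'); split; rewrite ?tensM //; exact: bmonM.
- exact: tensor_gen.
- exact: pquot_le_refl.
- exact: pquot_le_anti.
- exact: pquot_le_trans.
- exact: pquot_leD.
- exact: pquot_leM.
Defined.

Definition tensor_inl_fun (c : C) : Q := tens c 1.
Definition tensor_inr_fun (d : D) : Q := tens 1 d.

Lemma tensor_inl_nmod : nmod_morphism tensor_inl_fun.
Proof. by split=> [|x y]; [exact: tens0l | exact: tensDl]. Qed.
Lemma tensor_inl_monoid : monoid_morphism tensor_inl_fun.
Proof.
by split=> [|x y]; [exact: tens11 | rewrite /tensor_inl_fun -tensM mulr1].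
Qed.
Lemma tensor_inr_nmod : nmod_morphism tensor_inr_fun.
Proof. by split=> [|x y]; [exact: tens0r | exact: tensDr]. Qed.
Lemma tensor_inr_monoid : monoid_morphism tensor_inr_fun.
Proof.
by split=> [|x y]; [exact: tens11 | rewrite /tensor_inr_fun -tensM mulr1].
Qed.

HB.instance Definition _ :=
  GRing.isNmodMorphism.Build C Q tensor_inl_fun tensor_inl_nmod.
HB.instance Definition _ :=
  GRing.isMonoidMorphism.Build C Q tensor_inl_fun tensor_inl_monoid.
HB.instance Definition _ :=
  GRing.isNmodMorphism.Build D Q tensor_inr_fun tensor_inr_nmod.
HB.instance Definition _ :=
  GRing.isMonoidMorphism.Build D Q tensor_inr_fun tensor_inr_monoid.

Definition tensor_inl : obHom C tensor.
Proof.
apply: (@ObHom C tensor tensor_inl_fun) => [c mc|c c' cc'].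
  by exists c, 1; split=> //; exact: bmon1.
by apply/pquot_leP/genpre_in/tensor_lel.
Defined.

Definition tensor_inr : obHom D tensor.
Proof.
apply: (@ObHom D tensor tensor_inr_fun) => [d md|d d' dd'].
  by exists 1, d; split=> //; exact: bmon1.
by apply/pquot_leP/genpre_in/tensor_ler.
Defined.

Lemma tensor_pushout : is_pushout f g tensor_inl tensor_inr.
Proof.
split=> [b|E i' j' ij]; first exact: tens_bal.
have [G GE] := @monsr_lift nat (mulmon (C * D)%type) E
  (GRing.natmul 1) (fun p => i' p.1 * j' p.2)
  (etrans (congr2 *%R (rmorph1 i') (rmorph1 j')) (mulr1 1))
  (fun p q => etrans (congr2 *%R (rmorphM i' _ _) (rmorphM j' _ _))
                     (mulrACA _ _ _ _)).
have {}GE c d : G (ptens c d) = i' c * j' d by rewrite GE /= mul1r.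
have Gr x y : tensor_rel x y -> ble (G x) (G y).
  have Ge x' y' : tensor_eq x' y' -> G x' = G y'.
    case=> [c c' d|d|c d d'|c|b]; rewrite ?(rmorphD G) !GE ?rmorphD ?rmorph0.
    - by rewrite mulrDl.
    - by rewrite mul0r.
    - by rewrite mulrDr.
    - by rewrite mulr0.
    - by rewrite !rmorph1 mulr1 mul1r.
  case=> [{}x {}y /Ge ->|{}x {}y /Ge ->|c c' cc'|d d' dd'];
    [exact: ble_refl | exact: ble_refl | |]; rewrite !GE !rmorph1.
    by rewrite !mulr1; exact: hom_le.
  by rewrite !mul1r; exact: hom_le.
have Gle x y : genpre tensor_rel x y -> ble (G x) (G y).
  elim=> [{}x {}y /Gr //|{}x|{}x {}y z _ xy _ yz|{}x {}y z _ xy|{}x {}y z _ xy].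
  - exact: ble_refl.
  - exact: ble_trans xy yz.
  - by rewrite !rmorphD; exact: bleD.
  - by rewrite !rmorphM; exact: bleM.
have [H HE'] := @cquot_lift _ (symgenpre_congruence tensor_rel) _ G
  (fun x y xy => ble_anti (Gle _ _ xy.1) (Gle _ _ xy.2)).
have HE c d : H (tens c d) = i' c * j' d by rewrite [H _]HE' GE.
have Hmon (x : tensor) : bmon x -> bmon (H x).
  by move=> [c [d [mc md ->]]]; rewrite HE; apply: bmonM; exact: hom_mon.
have Hle (x y : tensor) : ble x y -> ble (H x) (H y).
  move=> [x' [y' [-> -> xy]]]; rewrite [H _]HE' [X in ble _ X]HE'; exact: Gle.
exists (ObHom Hmon Hle) => [|h' hi hj]; first split=> [c|d] /=.
- by rewrite [H _]HE rmorph1 mulr1.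
- by rewrite [H _]HE rmorph1 mul1r.
apply: obHom_ext => _ [c [d [_ _ ->]]]; rewrite /= HE -hi -hj -rmorphM /=.
by congr (h' _); rewrite /tensor_inl_fun /tensor_inr_fun -tensM mulr1 mul1r.
Qed.

End Tensor.

Section MSum.
Variable M : comMonoid0Type.

Definition msum_rel (x y : monsr nat M) : Prop := x = mono 1%N zerom /\ y = 0.

(* M^+; its elements are formal sums of the [fsum m], with [fsum zerom] = 0. *)
Definition msum : Type := cquot (gen_congruence msum_rel).
HB.instance Definition _ := GRing.ComPzSemiRing.on msum.

Definition fsum (m : M) : msum := cls (gen_congruence msum_rel) (mono 1%N m).

Lemma fsum0 : fsum zerom = 0.
Proof. by apply/clsP/gencong_in. Qed.
Lemma fsum1 : fsum 1%g = 1. Proof. by []. Qed.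
Lemma fsumM m n : fsum (m * n)%g = fsum m * fsum n.
Proof. by rewrite /fsum -rmorphM monoM. Qed.

Lemma msum_ind (P : msum -> Prop) :
  P 0 -> (forall x y, P x -> P y -> P (x + y)) ->
  (forall m, P (fsum m)) -> forall x, P x.
Proof.
move=> P0 PD Pm X; have [x ->] := cls_surj X.
elim/monsr_ind: x => [|x y Px Py|n m]; first by rewrite rmorph0.
  by rewrite rmorphD; exact: PD.
elim: n => [|n IH]; first by rewrite mono0 rmorph0.
by rewrite monoS rmorphD; apply: PD => //; exact: Pm.
Qed.

Lemma msum_gen (P : msum -> Prop) : P 0 -> P 1 ->
  (forall x y, P x -> P y -> P (x + y)) ->
  (forall x y, P x -> P y -> P (x * y)) ->
  (forall x, (exists m, x = fsum m) -> P x) -> forall x, P x.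
Proof.
by move=> P0 P1 PD PM Pm; apply: msum_ind => // m; apply: Pm; exists m.
Qed.

Let z i : monsr nat M := mono i zerom.

Lemma msum_relP x y :
  gencong msum_rel x y -> exists i j, x + z i = y + z j.
Proof.
have zM (f : monsr nat M) i : exists j, z i * f = z j.
  elim/monsr_ind: f => [|f g [j fj] [l gl]|c a].
  - by exists 0%N; rewrite mulr0 /z mono0.
  - by exists (j + l); rewrite mulrDr fj gl /z -monoD.
  - by exists (i * c); rewrite /z monoM mul0m.
elim=> {x y} [x y [-> ->]|x|x y _ [i [j xy]]|x y w _ [i [j xy]] _ [l [n yw]]
  |x y w _ [i [j xy]]|x y w _ [i [j xy]]].
- by exists 0%N, 1%N; rewrite /z mono0 addr0 add0r.
- by exists 0%N, 0%N.
- by exists j, i.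
- exists (i + l), (n + j); rewrite /z !monoD !addrA -/(z i) -/(z n) xy -yw.
  by rewrite addrAC.
- by exists i, j; rewrite addrAC xy addrAC.
- have [i' wi] := zM w i; have [j' wj] := zM w j.
  by exists i', j'; rewrite -wi -wj -!mulrDl xy.
Qed.

Lemma fsum_inj : injective fsum.
Proof.
move=> m n /clsP/msum_relP[i [j /fsfunP e]].
have [mz|mz] := eqVneq m zerom; last first.
  have := e m; rewrite !monsrD !monoE eqxx (negPf mz) !addr0.
  by case: eqP.
have := e n; rewrite !monsrD !monoE eqxx mz.
by case: eqP => // _; rewrite !addr0.
Qed.

(* Number of nonzero terms of a formal sum, used only to show that generated
   orders are antisymmetric. *)
Definition mdeg (x : msum) : nat :=
  mext (fun c m => if m == zerom then 0 else c) (repr x).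

Let deg0 : monsr nat M -> nat := mext (fun c m => if m == zerom then 0 else c).

Let deg0_m c m : deg0 (mono c m) = if m == zerom then 0 else c.
Proof. by apply: mext_mono => a; rewrite if_same. Qed.

Let deg0D x y : deg0 (x + y) = (deg0 x + deg0 y)%N.
Proof. by apply: mextD => [a|c d a]; case: ifP. Qed.

Let mdeg_cls x : mdeg (cls _ x) = deg0 x.
Proof.
have /msum_relP[i [j /(congr1 deg0)]] := repr_cls (gen_congruence msum_rel) x.
by rewrite !deg0D !deg0_m eqxx !addn0.
Qed.

Lemma mdeg0 : mdeg 0 = 0%N.
Proof. by rewrite -[0]/(cls _ 0) mdeg_cls /deg0 mext0. Qed.

Lemma mdeg_fsum m : mdeg (fsum m) = (m != zerom).
Proof. by rewrite mdeg_cls deg0_m; case: eqP. Qed.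

Lemma mdegD x y : mdeg (x + y) = (mdeg x + mdeg y)%N.
Proof.
have [x' ->] := cls_surj x; have [y' ->] := cls_surj y.
by rewrite -rmorphD !mdeg_cls deg0D.
Qed.

Lemma mdeg_eq0 x : mdeg x = 0%N -> x = 0.
Proof.
elim/msum_ind: x => // [x y IHx IHy|m].
  rewrite mdegD => /eqP; rewrite addn_eq0 => /andP[/eqP/IHx -> /eqP/IHy ->].
  by rewrite addr0.
by rewrite mdeg_fsum; case: eqP => // ->; rewrite fsum0.
Qed.

Section MSumOrder.
Variable r : msum -> msum -> Prop.
Hypothesis rM : forall m x y, r x y -> r (fsum m * x) (fsum m * y).
Hypothesis rdeg : forall x y, r x y -> (mdeg x < mdeg y)%N \/ x = y.

Lemma genpre_mdeg x y : genpre r x y -> forall m,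
  (mdeg (fsum m * x)%R < mdeg (fsum m * y)%R)%N \/ fsum m * x = fsum m * y.
Proof.
elim=> {x y} [x y xy|x|x y w _ xy _ yw|x y w _ xy|x y w _ xy] m.
- exact/rdeg/rM.
- by right.
- have [{}xy|->] := xy m; have [{}yw|<-] := yw m; [|by left|by left|by right].
  by left; exact: ltn_trans xy yw.
- rewrite !mulrDr !mdegD.
  by have [{}xy|->] := xy m; [left; rewrite ltn_add2r | right].
- elim/msum_ind: w => [|w w' IH IH'|n].
  + by right; rewrite !mulr0.
  + rewrite !mulrDr !mdegD.
    case: IH => [IH|->]; case: IH' => [IH'|->]; [| | |by right]; left.
    * by rewrite -addnS leq_add // ltnW.
    * by rewrite ltn_add2r.
    * by rewrite ltn_add2l.
  + by rewrite ![_ * fsum n]mulrC !mulrA -fsumM; exact: xy.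
Qed.

Lemma genpre_msum_anti x y : genpre r x y -> genpre r y x -> x = y.
Proof.
move=> /genpre_mdeg/(_ 1%g) + /genpre_mdeg/(_ 1%g); rewrite fsum1 !mul1r.
by move=> [xy|//] [yx|//]; have := ltn_trans xy yx; rewrite ltnn.
Qed.

(* (M, M^+, <=) with <= generated by r: the smallest additive and
   multiplicative preorder containing r is antisymmetric here, hence it is
   also the smallest such partial order. *)
Definition msumOB : ordBlueprint.
Proof.
apply: (@OrdBlueprint msum (fun x => exists m, x = fsum m) (genpre r)).
- by exists zerom; rewrite fsum0.
- by exists 1%g; rewrite fsum1.
- by move=> _ _ [m ->] [n ->]; exists (m * n)%g; rewrite fsumM.
- exact: msum_gen.
- exact: genpre_refl.
- exact: genpre_msum_anti.
- exact: genpre_trans.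
- exact: genpreD.
- exact: genpreM.
Defined.

Lemma msumOB_hom (C : ordBlueprint) (F : {rmorphism msum -> C}) :
  (forall x y, r x y -> ble (F x) (F y)) ->
  forall x y : msumOB, ble x y -> ble (F x) (F y).
Proof.
move=> Fr x y; elim=> {x y} [x y /Fr //|x|x y w _ xy _ yw|x y w _ xy|x y w _ xy].
- exact: ble_refl.
- exact: ble_trans xy yw.
- by rewrite !rmorphD; exact: bleD.
- by rewrite !rmorphM; exact: bleM.
Qed.

End MSumOrder.

End MSum.

Lemma msum_map (M N : comMonoid0Type) (u : M -> N) :
  u zerom = zerom -> u 1%g = 1%g -> (forall m n, u (m * n)%g = (u m * u n)%g) ->
  {F : {rmorphism msum M -> msum N} | forall m, F (fsum m) = fsum (u m)}.
Proof.
move=> u0 u1 uM.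
have [G GE] := @monsr_lift nat M (msum N) (GRing.natmul 1) (fun m => fsum (u m))
  (congr1 (@fsum N) u1) (fun m n => etrans (congr1 (@fsum N) (uM m n)) (fsumM _ _)).
have {}GE m : G (mono 1%N m) = fsum (u m) by rewrite GE /= mul1r.
have Ge x y : gencong (@msum_rel M) x y -> G x = G y.
  elim=> {x y} [x y [-> ->]|x|x y _ ->|x y w _ -> _ ->|x y w _ xy|x y w _ xy] //.
  - by rewrite GE u0 fsum0 rmorph0.
  - by rewrite !rmorphD xy.
  - by rewrite !rmorphM xy.
have [F FE] := @cquot_lift _ (gen_congruence (@msum_rel M)) _ G Ge.
by exists F => m; rewrite [F _]FE GE.
Qed.

Section RMon.
Variable R : comPzRingType.

Definition rmon_rel (x y : msum (mulmon R)) : Prop :=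
  exists a b c : mulmon R,
    [/\ (c : R) = (a : R) + (b : R), x = fsum c & y = fsum a + fsum b].

Lemma rmon_relM (m : mulmon R) x y :
  rmon_rel x y -> rmon_rel (fsum m * x) (fsum m * y).
Proof.
move=> [a [b [c [cab -> ->]]]]; exists (m * a)%g, (m * b)%g, (m * c)%g; split.
- by rewrite -[LHS]/((m : R) * c) cab mulrDr.
- by rewrite fsumM.
- by rewrite mulrDr !fsumM.
Qed.

Lemma rmon_rel_mdeg x y : rmon_rel x y -> (mdeg x < mdeg y)%N \/ x = y.
Proof.
move=> [a [b [c [cab -> ->]]]].
have [a0|a0] := eqVneq a zerom.
  right; rewrite a0 fsum0 add0r; congr fsum.
  by rewrite -[LHS]/(c : R) cab a0 add0r.
have [b0|b0] := eqVneq b zerom.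
  right; rewrite b0 fsum0 addr0; congr fsum.
  by rewrite -[LHS]/(c : R) cab b0 addr0.
by left; rewrite mdegD !mdeg_fsum a0 b0; case: eqP.
Qed.

Definition rmon : ordBlueprint := msumOB rmon_relM rmon_rel_mdeg.

End RMon.

Section Tropical.
Variable R : realType.

(* R_{>= 0} with the usual product and with max as addition. *)
Definition tropsf : Type := {nonneg R}.
HB.instance Definition _ := Choice.on tropsf.

Definition tropsf_add (x y : tropsf) : tropsf := (Num.max x%:num y%:num)%:nng.
Definition tropsf_mul (x y : tropsf) : tropsf := (x%:num * y%:num)%:nng.

Lemma tropsf_addA : associative tropsf_add.
Proof. by move=> x y z; apply: val_inj; rewrite /= maxA. Qed.
Lemma tropsf_addC : commutative tropsf_add.
Proof. by move=> x y; apply: val_inj; rewrite /= maxC. Qed.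
Lemma tropsf_add0 : left_id (0%:nng : tropsf) tropsf_add.
Proof. by move=> x; apply: val_inj; rewrite /= max_r. Qed.
HB.instance Definition _ :=
  GRing.isNmodule.Build tropsf tropsf_addA tropsf_addC tropsf_add0.

Lemma tropsf_mulA : associative tropsf_mul.
Proof. by move=> x y z; apply: val_inj; rewrite /= mulrA. Qed.
Lemma tropsf_mulC : commutative tropsf_mul.
Proof. by move=> x y; apply: val_inj; rewrite /= mulrC. Qed.
Lemma tropsf_mul1 : left_id (1%:nng : tropsf) tropsf_mul.
Proof. by move=> x; apply: val_inj; rewrite /= mul1r. Qed.
Lemma tropsf_mulDl : left_distributive tropsf_mul tropsf_add.
Proof. by move=> x y z; apply: val_inj; rewrite /= maxr_pMl. Qed.
Lemma tropsf_mul0 : left_zero (0%:nng : tropsf) tropsf_mul.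
Proof. by move=> x; apply: val_inj; rewrite /= mul0r. Qed.
HB.instance Definition _ := GRing.Nmodule_isComPzSemiRing.Build tropsf
  tropsf_mulA tropsf_mulC tropsf_mul1 tropsf_mulDl tropsf_mul0.

Definition max_twice (a b c : {nonneg R}) : Prop :=
  let m := Num.max a%:num (Num.max b%:num c%:num) in
  [\/ a%:num = m /\ b%:num = m, a%:num = m /\ c%:num = m
    | b%:num = m /\ c%:num = m].

Definition trop_rel (x y : msum (mulmon tropsf)) : Prop :=
  exists a b c : mulmon tropsf,
    [/\ max_twice a b c, x = fsum c & y = fsum a + fsum b].

Lemma trop_relM (m : mulmon tropsf) x y :
  trop_rel x y -> trop_rel (fsum m * x) (fsum m * y).
Proof.
move=> [a [b [c [abc -> ->]]]]; exists (m * a)%g, (m * b)%g, (m * c)%g; split.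
- have n0 : 0 <= (m : {nonneg R})%:num by [].
  rewrite /max_twice /= -!maxr_pMr //.
  by case: abc => -[e1 e2]; [apply: Or31|apply: Or32|apply: Or33]; split;
    congr (_ * _).
- by rewrite fsumM.
- by rewrite mulrDr !fsumM.
Qed.

Lemma max_twice0 (b c : {nonneg R}) : max_twice 0%:nng b c -> c = b.
Proof.
move=> h; apply: val_inj; move: h; rewrite /max_twice /=.
have : 0 <= b%:num by []. have : 0 <= c%:num by [].
move: b%:num c%:num => x y y0 x0.
by case: (leP x y) => ?; case: (leP 0 _) => ? [] [? ?]; lra.
Qed.

Lemma max_twiceC (a b c : {nonneg R}) : max_twice a b c -> max_twice b a c.
Proof.
rewrite /max_twice maxCA => -[] [? ?];
  [by apply: Or31|by apply: Or33|by apply: Or32].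
Qed.

Lemma trop_rel_mdeg x y : trop_rel x y -> (mdeg x < mdeg y)%N \/ x = y.
Proof.
move=> [a [b [c [abc -> ->]]]].
have [a0|a0] := eqVneq a zerom.
  right; rewrite a0 fsum0 add0r; congr fsum.
  by apply: max_twice0; move: abc; rewrite a0.
have [b0|b0] := eqVneq b zerom.
  right; rewrite b0 fsum0 addr0; congr fsum.
  by apply: max_twice0; move: abc; rewrite b0 => /max_twiceC.
by left; rewrite mdegD !mdeg_fsum a0 b0; case: eqP.
Qed.

Definition trop : ordBlueprint := msumOB trop_relM trop_rel_mdeg.

Definition tropelt (t : {nonneg R}) : trop := fsum (t : mulmon tropsf).

End Tropical.

Record nonarch_absval (R : realType) (k : fieldType) (v : k -> {nonneg R}) :
    Prop := NonarchAbsval {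
  absval0 : (v 0)%:num = 0;
  absval1 : (v 1)%:num = 1;
  absvalM : forall a b, (v (a * b))%:num = (v a)%:num * (v b)%:num;
  absvalD : forall a b, (v (a + b))%:num <= Num.max (v a)%:num (v b)%:num
}.

Section AbsvalMorphism.
Variables (R : realType) (k : fieldType) (v : k -> {nonneg R}).
Hypothesis hv : nonarch_absval v.

Lemma absvalN a : (v (- a))%:num = (v a)%:num.
Proof.
suff e : (v (-1))%:num = 1 by rewrite -mulN1r (absvalM hv) e mul1r.
have : (v (-1))%:num ^+ 2 = 1 by rewrite expr2 -(absvalM hv) mulrNN mulr1 (absval1 hv).
by move/eqP; rewrite sqrf_eq1 => /orP[/eqP //|/eqP e]; have : 0 <= (v (-1))%:num by [];
  rewrite e oppr_ge0 ler10.
Qed.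

Lemma absval_max_twice a b : max_twice (v a) (v b) (v (a + b)).
Proof.
have := absvalD hv a b; have := absvalD hv (a + b) (- b).
have := absvalD hv (a + b) (- a); rewrite !absvalN addrK addrAC subrr add0r.
rewrite /max_twice.
move: (v a)%:num (v b)%:num (v (a + b))%:num => x y z.
rewrite !le_max => /orP h1 /orP h2 /orP h3.
case: (leP y z) => yz; case: leP => xyz; case: h1 => ?; case: h2 => ?;
  case: h3 => ?;
  by [apply: Or31; split; lra | apply: Or32; split; lra
     | apply: Or33; split; lra].
Qed.

Let vm (a : mulmon k) : mulmon (tropsf R) := v a.
Let vm0 : vm zerom = zerom. Proof. exact/val_inj/(absval0 hv). Qed.
Let vm1 : vm 1%g = 1%g. Proof. exact/val_inj/(absval1 hv). Qed.
Let vmM (a b : mulmon k) : vm (a * b)%g = (vm a * vm b)%g.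
Proof. exact/val_inj/(absvalM hv). Qed.

Definition absval_fun : {rmorphism msum (mulmon k) -> msum (mulmon (tropsf R))} :=
  sval (msum_map vm0 vm1 vmM).

Lemma absval_funE (a : mulmon k) :
  absval_fun (fsum a) = fsum (v a : mulmon (tropsf R)).
Proof. exact: (svalP (msum_map vm0 vm1 vmM)). Qed.

Definition absval_hom : obHom (rmon k) (trop R).
Proof.
apply: (@ObHom (rmon k) (trop R) absval_fun) => [_ [a ->]|].
  by exists (v a); exact: absval_funE.
apply: (@msumOB_hom _ _ _ _ (trop R)) => _ _ [a [b [c [cab -> ->]]]].
apply: genpre_in; exists (v a), (v b), (v c); split.
- by rewrite cab; exact: absval_max_twice.
- exact: absval_funE.
- by rewrite rmorphD !absval_funE.
Defined.

End AbsvalMorphism.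

Section Assoc.
Variables (k : fieldType) (A : comMonoidType) (R : comPzRingType).
Variable iota : {rmorphism monsr k A -> R}.

Definition assocmon : Type := {x : R | `[< exists c a, x = iota (mono c a) >]}.
HB.instance Definition _ := Choice.on assocmon.

Fact assocelt_subproof c a : `[< exists c' a', iota (mono c a) = iota (mono c' a') >].
Proof. by apply/asboolP; exists c, a. Qed.

Definition assocelt (c : k) (a : A) : assocmon :=
  exist _ (iota (mono c a)) (assocelt_subproof c a).

Fact assocmon_mul_subproof (x y : assocmon) :
  `[< exists c a, sval x * sval y = iota (mono c a) >].
Proof.
apply/asboolP; have /asboolP[c [a ->]] := svalP x.
have /asboolP[d [b ->]] := svalP y.
by exists (c * d), (a * b)%g; rewrite -rmorphM monoM.
Qed.

Definition assocmon_mul (x y : assocmon) : assocmon :=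
  exist _ (sval x * sval y) (assocmon_mul_subproof x y).

Lemma assocmon_mulA : associative assocmon_mul.
Proof. by move=> x y z; apply: val_inj; rewrite /= mulrA. Qed.
Lemma assocmon_mulC : commutative assocmon_mul.
Proof. by move=> x y; apply: val_inj; rewrite /= mulrC. Qed.
Lemma assocmon_mul1 : left_id (assocelt 1 1%g) assocmon_mul.
Proof. by move=> x; apply: val_inj; rewrite /= mono1 rmorph1 mul1r. Qed.
Lemma assocmon_mulr1 : right_id (assocelt 1 1%g) assocmon_mul.
Proof. by move=> x; rewrite assocmon_mulC assocmon_mul1. Qed.
Lemma assocmon_mul0 : left_zero (assocelt 0 1%g) assocmon_mul.
Proof. by move=> x; apply: val_inj; rewrite /= mono0 rmorph0 mul0r. Qed.

HB.instance Definition _ := isSemigroup.Build assocmon assocmon_mulA.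
HB.instance Definition _ :=
  Semigroup_isMonoid.Build assocmon assocmon_mul1 assocmon_mulr1.
HB.instance Definition _ := Monoid_isCommutative.Build assocmon assocmon_mulC.
HB.instance Definition _ := ComMonoid_hasZero.Build assocmon assocmon_mul0.

Definition assoc_rel (x y : msum assocmon) : Prop :=
  exists (c : k) (a : A) (s : seq (k * A)),
    [/\ iota (mono c a) = \sum_(p <- s) iota (mono p.1 p.2),
        x = fsum (assocelt c a) &
        y = \sum_(p <- s) fsum (assocelt p.1 p.2)].

Lemma assocmonP (x : assocmon) : exists c a, x = assocelt c a.
Proof.
by have /asboolP[c [a e]] := svalP x; exists c, a; apply: val_inj.
Qed.

Lemma assoceltM c d a b : assocelt (c * d) (a * b)%g = (assocelt c a * assocelt d b)%g.
Proof. by apply: val_inj; rewrite /= -rmorphM monoM. Qed.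

Lemma assoc_relM (m : assocmon) x y :
  assoc_rel x y -> assoc_rel (fsum m * x) (fsum m * y).
Proof.
have [d [b ->]] := assocmonP m => -[c [a [s [e -> ->]]]].
exists (d * c), (b * a)%g, [seq (d * p.1, (b * p.2)%g) | p <- s]; split.
- rewrite -monoM rmorphM e mulr_sumr big_map; apply: eq_bigr => p _ /=.
  by rewrite -monoM rmorphM.
- by rewrite assoceltM fsumM.
- by rewrite mulr_sumr big_map; apply: eq_bigr => p _ /=; rewrite assoceltM fsumM.
Qed.

Lemma assoc_rel_mdeg x y : assoc_rel x y -> (mdeg x < mdeg y)%N \/ x = y.
Proof.
have z0 c a : (assocelt c a == zerom) = (iota (mono c a) == 0).
  by rewrite -val_eqE /= mono0 rmorph0.
have key (s : seq (k * A)) :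
    [\/ \sum_(p <- s) fsum (assocelt p.1 p.2) = 0
         /\ \sum_(p <- s) iota (mono p.1 p.2) = 0,
        exists d b, \sum_(p <- s) fsum (assocelt p.1 p.2) = fsum (assocelt d b)
         /\ \sum_(p <- s) iota (mono p.1 p.2) = iota (mono d b) |
        (1 < mdeg (\sum_(p <- s) fsum (assocelt p.1 p.2))%R)%N].
  elim: s => [|[d b] s IH]; first by apply: Or31; rewrite !big_nil.
  rewrite !big_cons /=.
  have [/eqP db0|db0] := boolP (assocelt d b == zerom).
    have /eqP := db0; rewrite z0 => /eqP ->.
    by rewrite db0 fsum0 !add0r.
  case: IH => [[-> ->]|[d' [b' [-> ->]]]|h].
  - by apply: Or32; exists d, b; rewrite !addr0.
  - have [/eqP db0'|db0'] := boolP (assocelt d' b' == zerom).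
      have /eqP := db0'; rewrite z0 => /eqP ->.
      by apply: Or32; exists d, b; rewrite db0' fsum0 !addr0.
    by apply: Or33; rewrite mdegD !mdeg_fsum db0 db0'.
  - by apply: Or33; rewrite mdegD; apply: leq_trans h _; exact: leq_addl.
move=> [c [a [s [e -> ->]]]].
case: (key s) => [[y0 e0]|[d [b [yE eE]]]|h].
- right; rewrite y0 -(@fsum0 assocmon); congr fsum.
  by apply/eqP; rewrite z0 e e0.
- by right; rewrite yE; congr fsum; apply: val_inj; rewrite /= e eE.
- by left; apply: leq_trans h; rewrite mdeg_fsum; case: eqP.
Qed.

Definition assocOB : ordBlueprint := msumOB assoc_relM assoc_rel_mdeg.

Definition assocOBelt (c : k) (a : A) : assocOB := fsum (assocelt c a).

Let um (c : mulmon k) : assocmon := assocelt c 1%g.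
Let um0 : um zerom = zerom. Proof. by []. Qed.
Let um1 : um 1%g = 1%g. Proof. by []. Qed.
Let umM (c d : mulmon k) : um (c * d)%g = (um c * um d)%g.
Proof. by rewrite /um -assoceltM mulg1. Qed.

Definition assoc_str_fun : {rmorphism msum (mulmon k) -> msum assocmon} :=
  sval (msum_map um0 um1 umM).

Lemma assoc_str_funE (c : mulmon k) :
  assoc_str_fun (fsum c) = fsum (assocelt c 1%g).
Proof. exact: (svalP (msum_map um0 um1 umM)). Qed.

Definition assoc_str : obHom (rmon k) assocOB.
Proof.
apply: (@ObHom (rmon k) assocOB assoc_str_fun) => [_ [c ->]|].
  by exists (assocelt c 1%g); exact: assoc_str_funE.
apply: (@msumOB_hom _ _ _ _ assocOB) => _ _ [a [b [c [cab -> ->]]]].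
apply: genpre_in; exists c, 1%g, [:: ((a : k), 1%g); ((b : k), 1%g)].
rewrite !big_cons !big_nil !addr0; split.
- by rewrite cab monoD rmorphD.
- exact: assoc_str_funE.
- by rewrite rmorphD !assoc_str_funE.
Defined.

End Assoc.

Section Bend.
Variables (T : realType) (k : fieldType) (v : k -> {nonneg T}).
Variables (A : comMonoidType) (R : comPzRingType).
Variable iota : {rmorphism monsr k A -> R}.

Definition tmono (t : {nonneg T}) (a : A) : monsr (tropsf T) A :=
  mono (t : tropsf T) a.

Definition bend_rel (x y : monsr (tropsf T) A) : Prop :=
  exists (c : k) (a : A) (s : seq (k * A)),
    [/\ iota (mono c a - \sum_(p <- s) mono p.1 p.2) = 0,
        x = tmono (v c) a + \sum_(p <- s) tmono (v p.1) p.2 &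
        y = \sum_(p <- s) tmono (v p.1) p.2].

Definition bendGG : Type := cquot (gen_congruence bend_rel).
HB.instance Definition _ := GRing.ComPzSemiRing.on bendGG.

Definition bend_cls (t : {nonneg T}) (a : A) : bendGG :=
  cls (gen_congruence bend_rel) (tmono t a).

Definition bend_mon (x : bendGG) : Prop := exists t a, x = bend_cls t a.

Definition bend : ordBlueprint.
Proof.
apply: (@trivob bendGG bend_mon).
- by exists 0%:nng, 1%g; rewrite /bend_cls /tmono [mono _ _]mono0 rmorph0.
- by exists 1%:nng, 1%g.
- move=> _ _ [t [a ->]] [u [b ->]].
  exists ((t : tropsf T) * (u : tropsf T)), (a * b)%g.
  by rewrite /bend_cls /tmono -rmorphM monoM.
- move=> P P0 P1 PD PM Pm X; have [x ->] := cls_surj X.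
  elim/monsr_ind: x => [|x y Px Py|t a]; first by rewrite rmorph0.
    by rewrite rmorphD; exact: PD.
  by apply: Pm; exists t, a.
Defined.

End Bend.

(* The opposite of the category of ordered blueprints. *)
Record affOB := Spec { coordOB : ordBlueprint }.

Definition affHom (X Y : affOB) : Type := obHom (coordOB Y) (coordOB X).
Definition aff_iso (X Y : affOB) (f : affHom X Y) : Prop := ob_iso f.

Definition aff_idem (Z : affOB) : affOB := Spec (ob_idem (coordOB Z)).
Definition aff_pos (Z : affOB) : affOB := Spec (ob_pos (coordOB Z)).
Definition aff_core (Z : affOB) : affOB := Spec (ob_core (coordOB Z)).

Section Trop.
Variables (T : realType) (k : fieldType) (v : k -> {nonneg T}).
Hypothesis hv : nonarch_absval v.
Variables (Y : affOB) (s : obHom (rmon k) (coordOB Y)).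

Definition Trop : affOB := Spec (tensor s (absval_hom hv)).

Definition trop_elt (b : coordOB Y) (t : {nonneg T}) : coordOB Trop :=
  tensor_inl s (absval_hom hv) b * tensor_inr s (absval_hom hv) (tropelt t).

End Trop.

(* Main.v *)
(** In an idempotent semiring every compatible order with [0 <= 1] is the
    natural order [x + y = y].  The relations [0 <= 1 + 1] and, for [a <= b],
    [a <= b + b] of the tropical hyperfield therefore turn
    [Trop(Y)^idem] into a naturally ordered idempotent semiring in which the
    sum of two scalars is their maximum.  In a naturally ordered semiring the
    relations [c_a a <= sum_j c_j b_j] defining [B] are exactly the bend
    relations, so that the universal properties of the tensor product and of
    [Bend^GG] provide mutually inverse maps, both determined by
    [iota(c a) (x) t <-> (v(c) t) a]. *)
Require Import Defs.
From HB Require Import structures.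
From mathcomp Require Import all_boot all_order all_algebra finmap.
From mathcomp Require Import interval_inference boolp reals.

Set Implicit Arguments.
Unset Strict Implicit.
Unset Printing Implicit Defensive.

Import Order.TTheory GRing.Theory Num.Theory.

Local Open Scope ring_scope.

(** * Morphisms of ordered blueprints and maps out of quotients *)

Section Category.
Variables B C D : ordBlueprint.

Definition ob_id : obHom B B :=
  @ObHom B B idfun (fun x mx => mx) (fun x y xy => xy).

Definition ob_comp (g : obHom C D) (f : obHom B C) : obHom B D :=
  @ObHom B D (hom_fun g \o hom_fun f)
    (fun x mx => hom_mon g (hom_mon f mx))
    (fun x y xy => hom_le g (hom_le f xy)).

(** The order of [C] pulled back along [F] is an additive and multiplicative preorder, so it
    contains the one generated by [r] as soon as it contains [r]. *)
Lemma genpre_hom (S : comPzSemiRingType) (r : S -> S -> Prop)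
    (F : {rmorphism S -> C}) :
  (forall x y, r x y -> ble (F x) (F y)) ->
  forall x y, genpre r x y -> ble (F x) (F y).
Proof.
move=> Fr x y; elim=> {x y} [x y /Fr //|x|x y w _ xy _ yw|x y w _ xy|x y w _ xy].
- exact: ble_refl.
- exact: ble_trans xy yw.
- by rewrite !rmorphD; exact: bleD.
- by rewrite !rmorphM; exact: bleM.
Qed.

Lemma obquot_lift (r : B -> B -> Prop) (f : obHom B C) :
  (forall x y, r x y -> ble (f x) (f y)) ->
  {F : obHom (obquot r) C | forall x, F (obquot_cls r x) = f x}.
Proof.
move=> fr.
have fle x y : genpre (obquot_rel r) x y -> ble (f x) (f y).
  by apply: (@genpre_hom _ _ (hom_fun f)) => {}x {}y [/hom_le|/fr].
have [F FE] := @cquot_lift _ (symgenpre_congruence (obquot_rel r)) _ (hom_fun f)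
  (fun x y xy => ble_anti (fle _ _ xy.1) (fle _ _ xy.2)).
have Fmon (x : obquot r) : bmon x -> bmon (F x).
  by move=> [y my ->]; rewrite [F _]FE; exact: hom_mon.
have Fle (x y : obquot r) : ble x y -> ble (F x) (F y).
  move=> [x' [y' [-> -> xy]]]; rewrite [F _]FE [X in ble _ X]FE; exact: fle.
by exists (ObHom Fmon Fle) => x; exact: FE.
Qed.

End Category.

Lemma ob_isoI (B C : ordBlueprint) (f : obHom B C) (g : obHom C B) :
  (forall x, bmon x -> g (f x) = x) -> (forall y, bmon y -> f (g y) = y) ->
  ob_iso f.
Proof.
move=> gf fg; exists g; split.
  exact: (@obHom_ext _ _ (ob_comp g f) (ob_id B)).
exact: (@obHom_ext _ _ (ob_comp f g) (ob_id C)).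
Qed.

(** * Idempotent semirings and their natural order *)

Section NaturalOrder.
Variable B : ordBlueprint.
Hypothesis idemB : 1 + 1 = 1 :> B.

Lemma idem_addrr (x : B) : x + x = x.
Proof. by rewrite -[x]mulr1 -mulrDr idemB. Qed.

(** Scaling [0 <= 1] makes every element nonnegative. Then [x <= y] gives [x + y <= y + y = y] and
    [y <= x + y], hence equality; conversely [x <= x + y]. *)
Lemma ble_natural : ble (0 : B) 1 ->
  forall x y : B, ble x y <-> x + y = y.
Proof.
move=> le01.
have le0 (x : B) : ble 0 x by have := bleM x le01; rewrite mul0r mul1r.
move=> x y; split=> [xy|<-].
  apply: ble_anti; first by rewrite -[X in ble _ X]idem_addrr; exact: bleD.
  by have := bleD y (le0 x); rewrite add0r.
by have := bleD x (le0 y); rewrite add0r addrC.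
Qed.

(** A stand-in for [ob_pos B] in which inequalities are semiring identities, so that morphisms into
    it are checked by equations. *)
Definition natob : ordBlueprint.
Proof.
apply: (@OrdBlueprint B (@bmon B) (fun x y => x + y = y)
  (bmon0 B) (bmon1 B) (@bmonM B) (@bmon_gen B)).
- exact: idem_addrr.
- by move=> x y xy yx; rewrite -xy addrC.
- by move=> x y z xy <-; rewrite addrA xy.
- by move=> x y z xy; rewrite addrACA xy idem_addrr.
- by move=> x y z xy; rewrite -mulrDl xy.
Defined.

Definition natob_pos : obHom natob (ob_pos B).
Proof.
apply: (@ObHom natob (ob_pos B) (hom_fun (pos_cls B))).
  by move=> x mx; exact: (hom_mon (pos_cls B) mx).
move=> x y xy.
have le01 : ble (0 : ob_pos B) 1.
  rewrite -(rmorph0 (pos_cls B)) -(rmorph1 (pos_cls B)).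
  by apply/pquot_leP/genpre_in; right.
have le0 (z : ob_pos B) : ble 0 z by have := bleM z le01; rewrite mul0r mul1r.
rewrite -[X in ble _ (_ X)]xy rmorphD.
by have := bleD (pos_cls B x) (le0 (pos_cls B y)); rewrite add0r addrC.
Defined.

(** Produces both isomorphisms of the theorem from one pair of maps inverse on monoids. [G] descends
    to [ob_pos B] because [0 <= 1] holds in [C]; passing to the core of [C] leaves only equalities
    to preserve, so [F] may also be read as a map into the trivially ordered [B]. *)
Lemma natob_iso (C : ordBlueprint) (F : obHom C natob) (G : obHom B C) :
  (forall x y : B, ble x y -> x = y) -> ble (0 : C) 1 ->
  (forall x : B, bmon x -> F (G x) = x) -> (forall y, bmon y -> G (F y) = y) ->
  exists (Phi : obHom C (ob_pos B)) (Psi : obHom (ob_core C) B),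
    [/\ ob_iso Phi, ob_iso Psi, forall y, Phi y = pos_cls B (F y) &
        forall y, Psi y = F y].
Proof.
move=> trivB le01 FG GF.
have Gpos x y : x = 0 /\ y = 1 -> ble (G x) (G y).
  by case=> -> ->; rewrite rmorph0 rmorph1.
have [G' G'E] := obquot_lift Gpos.
pose Phi := ob_comp natob_pos F.
pose Psi := @ObHom (ob_core C) B (hom_fun F) (@hom_mon _ _ F)
  (fun x y xy => eq_ind x (fun z => ble (F x : B) (F z)) (ble_refl _) y xy).
pose Gc := @ObHom B (ob_core C) (hom_fun G) (@hom_mon _ _ G)
  (fun x y xy => congr1 G (trivB x y xy)).
exists Phi, Psi; split=> //; last first.
  by apply: (@ob_isoI _ _ Psi Gc) => x; [exact: GF | exact: FG].
apply: (@ob_isoI _ _ Phi G') => [y my|_ [x mx ->]].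
  by apply: (etrans (G'E (F y))); exact: GF.
apply: (congr1 (pos_cls B)); apply: etrans (FG x mx).
by apply: (congr1 F); exact: G'E.
Qed.

End NaturalOrder.

(** The universal property of [M^+]: the lift to [N[M]] respects the identification of the zero of
    [M] with the empty sum. *)
Lemma msum_lift (M : comMonoid0Type) (E : comPzSemiRingType) (u : M -> E) :
  u zerom = 0 -> u 1%g = 1 -> (forall m n, u (m * n)%g = u m * u n) ->
  {F : {rmorphism msum M -> E} | forall m, F (fsum m) = u m}.
Proof.
move=> u0 u1 uM.
have [G GE] := @monsr_lift nat M E (GRing.natmul 1) u u1 uM.
have {}GE m : G (mono 1%N m) = u m by rewrite GE /= mul1r.
have Ge x y : gencong (@msum_rel M) x y -> G x = G y.
  elim=> {x y} [x y [-> ->]|x|x y _ ->|x y w _ -> _ ->|x y w _ xy|x y w _ xy] //.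
  - by rewrite GE u0 rmorph0.
  - by rewrite !rmorphD xy.
  - by rewrite !rmorphM xy.
have [F FE] := @cquot_lift _ (gen_congruence (@msum_rel M)) _ G Ge.
by exists F => m; rewrite [F _]FE GE.
Qed.

(** * The map from the idempotent tropicalization to the bend *)

Section TropToBend.
Variables (T : realType) (k : fieldType) (v : k -> {nonneg T}).
Hypothesis hv : nonarch_absval v.
Variables (A : comMonoidType) (R : comPzRingType).
Variable iota : {rmorphism monsr k A -> R}.

Local Notation bcls := (bend_cls v iota).

Lemma tropsf_addrr (t : tropsf T) : t + t = t.
Proof. by apply: val_inj; rewrite /= maxxx. Qed.

Lemma bend_idem : 1 + 1 = 1 :> bend v iota.
Proof.
rewrite -[1]/(bcls 1%:nng 1%g) -[_ + _]rmorphD /tmono -[_ + _]monoD.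
by rewrite [(_ : tropsf T) + _]tropsf_addrr.
Qed.

Local Notation N := (natob bend_idem).

Lemma bend_clsM t u a b :
  bcls (t%:num * u%:num)%:nng (a * b)%g = bcls t a * bcls u b.
Proof. by rewrite /bend_cls /tmono -rmorphM monoM. Qed.

Lemma bend_clsD t u a :
  bcls (Num.max t%:num u%:num)%:nng a = bcls t a + bcls u a.
Proof. by rewrite /bend_cls /tmono -rmorphD -monoD. Qed.

Lemma bend_le (c : k) (a : A) (s : seq (k * A)) :
  iota (mono c a) = \sum_(p <- s) iota (mono p.1 p.2) ->
  bcls (v c) a + \sum_(p <- s) bcls (v p.1) p.2 =
  \sum_(p <- s) bcls (v p.1) p.2.
Proof.
move=> e; rewrite /bend_cls -rmorph_sum -rmorphD.
apply/clsP/gencong_in; exists c, a, s; split=> //.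
by rewrite rmorphB rmorph_sum e subrr.
Qed.

Lemma bend_cls_le c a d b : iota (mono c a) = iota (mono d b) ->
  bcls (v c) a + bcls (v d) b = bcls (v d) b.
Proof. by move=> e; have := @bend_le c a [:: (d, b)]; rewrite !big_seq1; apply. Qed.

(** Two one-term bend relations, one in each direction, make each class absorb the other. *)
Lemma bend_cls_eq c a d b : iota (mono c a) = iota (mono d b) ->
  bcls (v c) a = bcls (v d) b.
Proof. by move=> e; rewrite -(bend_cls_le e) addrC bend_cls_le. Qed.

(** An element of [assocmon] has no preferred form [iota(c a)], so one is chosen; by [bend_cls_eq]
    the value does not depend on the choice. *)
Definition assoc_bend_fun (x : assocmon iota) : bendGG v iota :=
  let c := cid (assocmonP x) in let a := cid (svalP c) in
  bcls (v (sval c)) (sval a).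

Lemma assoc_bend_funE c a : assoc_bend_fun (assocelt iota c a) = bcls (v c) a.
Proof.
rewrite /assoc_bend_fun; case: cid => d /= e; case: cid => b /= {}e.
by apply: bend_cls_eq; have /(congr1 sval) := e.
Qed.

Lemma assoc_bend :
  {F : obHom (assocOB iota) N |
    forall c a, F (assocOBelt iota c a) = bcls (v c) a}.
Proof.
have v0 : v 0 = 0%:nng by exact/val_inj/(absval0 hv).
have v1 : v 1 = 1%:nng by exact/val_inj/(absval1 hv).
have vM c d : v (c * d) = ((v c)%:num * (v d)%:num)%:nng.
  exact/val_inj/(absvalM hv).
have u0 : assoc_bend_fun zerom = 0.
  by rewrite assoc_bend_funE v0 /bend_cls /tmono [mono _ _]mono0 rmorph0.
have u1 : assoc_bend_fun 1%g = 1 by rewrite assoc_bend_funE v1.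
have uM x y : assoc_bend_fun (x * y)%g = assoc_bend_fun x * assoc_bend_fun y.
  have [c [a ->]] := assocmonP x; have [d [b ->]] := assocmonP y.
  by rewrite -assoceltM !assoc_bend_funE vM bend_clsM.
have [F FE] := msum_lift u0 u1 uM.
have {}FE c a : F (assocOBelt iota c a) = bcls (v c) a.
  by rewrite [F _]FE assoc_bend_funE.
have Fmon (x : assocOB iota) : bmon x -> bmon (F x : N).
  move=> [m ->]; have [c [a ->]] := assocmonP m.
  by exists (v c), a; rewrite [F _]FE.
have Fle (x y : assocOB iota) : ble x y -> ble (F x : N) (F y).
  apply: (@msumOB_hom _ _ _ _ N) => _ _ [c [a [s [e -> ->]]]].
  rewrite rmorph_sum [F _]FE.
  under eq_bigr do rewrite [F _]FE.
  exact: bend_le.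
by exists (@ObHom (assocOB iota) N F Fmon Fle) => c a; exact: FE.
Qed.

(** Two of the three entries attain the maximum, so at least one of [a] and [b] does. *)
Lemma max_twice_le (a b c : {nonneg T}) : max_twice a b c ->
  c%:num <= Num.max a%:num b%:num.
Proof.
rewrite /max_twice; set m := Num.max _ _.
have cm : c%:num <= m by rewrite !le_max lexx !orbT.
by rewrite le_max; case=> -[e _]; rewrite e cm ?orbT.
Qed.

Lemma trop_bend :
  {F : obHom (trop T) N | forall t, F (tropelt t) = bcls t 1%g}.
Proof.
pose u (t : mulmon (tropsf T)) : bendGG v iota := bcls t 1%g.
have u0 : u zerom = 0 by rewrite /u /bend_cls /tmono [mono _ _]mono0 rmorph0.
have uM x y : u (x * y)%g = u x * u y by rewrite /u -bend_clsM mulg1.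
have [F FE] := msum_lift u0 erefl uM.
have Fmon (x : trop T) : bmon x -> bmon (F x : N).
  by move=> [t ->]; exists t, 1%g; rewrite FE.
have Fle (x y : trop T) : ble x y -> ble (F x : N) (F y).
  apply: (@msumOB_hom _ _ _ _ N) => _ _ [a [b [c [abc -> ->]]]].
  (* Unfolds the order of [N]; the sum of two scalar classes is the class of their maximum, so the
     claim becomes [c <= max(a, b)]. *)
  rewrite rmorphD !FE; change (u c + (u a + u b) = u a + u b).
  rewrite /u -!bend_clsD; congr bend_cls; apply: val_inj.
  exact/max_idPr/max_twice_le.
by exists (@ObHom (trop T) N F Fmon Fle) => t; exact: FE.
Qed.

Local Notation BT := (tensor (assoc_str iota) (absval_hom hv)).
Local Notation elt c a t :=
  (trop_elt hv (Y := Spec (assocOB iota)) (assoc_str iota)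
     (assocOBelt iota c a) t).

Lemma tensor_bend :
  {F : obHom (ob_idem BT) N | forall c a t,
    F (idem_cls BT (elt c a t)) = bcls ((v c)%:num * t%:num)%:nng a}.
Proof.
have [i iE] := assoc_bend; have [j jE] := trop_bend.
(* The two maps agree over [k]: both send [c] to the class of [v(c)] times the unit of [A]. *)
have ij b : i (assoc_str iota b) = j (absval_hom hv b).
  apply: (@obHom_ext _ _ (ob_comp i (assoc_str iota)) (ob_comp j (absval_hom hv))).
  move=> _ [c ->] /=; rewrite assoc_str_funE absval_funE.
  by rewrite [i _]iE [j _]jE.
have [_ /(_ N i j ij)/cid2[h [hi hj] _]] :=
  tensor_pushout (assoc_str iota) (absval_hom hv).
have idem_le x y : (x = 1 + 1 /\ y = 1) \/ (x = 1 /\ y = 1 + 1) ->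
    ble (h x) (h y).
  have e : h (1 + 1) = h 1 by rewrite rmorphD !rmorph1; exact: bend_idem.
  by case=> -[-> ->]; rewrite e; exact: ble_refl.
have [F FE] := obquot_lift idem_le.
exists F => c a t; apply: (etrans (FE _)).
have hM := rmorphM h (tensor_inl (assoc_str iota) (absval_hom hv)
  (assocOBelt iota c a)) (tensor_inr (assoc_str iota) (absval_hom hv) (tropelt t)).
apply: (etrans hM); rewrite -[in RHS](mulg1 a) bend_clsM.
apply: (congr2 *%R); first exact: etrans (hi _) (iE _ _).
exact: etrans (hj _) (jE _).
Qed.

(** * Maps from the bend to an idempotent blueprint under [B] and the tropical hyperfield *)

Section BendUniversal.
Variables (E : ordBlueprint) (i : obHom (assocOB iota) E) (j : obHom (trop T) E).
Hypothesis ij : forall b, i (assoc_str iota b) = j (absval_hom hv b).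
Hypothesis idemE : 1 + 1 = 1 :> E.

Lemma trop_hom_le (a b c : {nonneg T}) : max_twice a b c ->
  ble (j (tropelt c)) (j (tropelt a) + j (tropelt b)).
Proof.
move=> abc; rewrite -rmorphD; apply: hom_le; apply: genpre_in.
by exists a, b, c.
Qed.

Lemma trop_hom0 : j (tropelt 0%:nng) = 0.
Proof. by rewrite -(rmorph0 j); congr (j _); exact: fsum0. Qed.

Lemma trop_hom1 : j (tropelt 1%:nng) = 1.
Proof. exact: (rmorph1 j). Qed.

Lemma trop_hom_le01 : ble (0 : E) 1.
Proof.
(* Among [1, 1, 0] the maximum occurs twice, so [0 <= 1 + 1] in the hyperfield. *)
rewrite -idemE -trop_hom1 -trop_hom0; apply: trop_hom_le.
by apply: Or31; rewrite /= (max_l ler01) maxxx.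
Qed.

Lemma trop_hom_leE (x y : E) : ble x y <-> x + y = y.
Proof. exact: ble_natural idemE trop_hom_le01 x y. Qed.

Lemma trop_hom_homo (t u : {nonneg T}) : t%:num <= u%:num ->
  j (tropelt t) + j (tropelt u) = j (tropelt u).
Proof.
(* Writing [u] as [u + u] repeats the maximum among [u, u, t]. *)
move=> tu; apply/trop_hom_leE; rewrite -(idem_addrr idemE (j (tropelt u))).
by apply: trop_hom_le; apply: Or31; rewrite (max_l tu) maxxx.
Qed.

Lemma trop_homD (t u : {nonneg T}) :
  j (tropelt (Num.max t%:num u%:num)%:nng) = j (tropelt t) + j (tropelt u).
Proof.
case/orP: (le_total t%:num u%:num) => [tu|ut].
  have -> : (Num.max t%:num u%:num)%:nng = u by exact/val_inj/max_idPr.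
  by rewrite trop_hom_homo.
have -> : (Num.max t%:num u%:num)%:nng = t by exact/val_inj/max_idPl.
by rewrite addrC trop_hom_homo.
Qed.

Lemma trop_homM (t u : {nonneg T}) :
  j (tropelt (t%:num * u%:num)%:nng) = j (tropelt t) * j (tropelt u).
Proof.
rewrite -rmorphM; congr (j _).
exact: (@fsumM (mulmon (tropsf T)) t u).
Qed.

Lemma assocOBeltM c d a b : assocOBelt iota (c * d) (a * b)%g =
  assocOBelt iota c a * assocOBelt iota d b.
Proof. by rewrite /assocOBelt assoceltM; exact: fsumM. Qed.

(** Factor [c a] as [(c 1)(1 a)] and carry the scalar across by [ij]. *)
Lemma assoc_hom_scal (c : k) (a : A) :
  i (assocOBelt iota c a) = j (tropelt (v c)) * i (assocOBelt iota 1 a).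
Proof.
rewrite -{1}[c]mulr1 -{1}[a]mul1g assocOBeltM rmorphM; congr (_ * _).
have eB : assoc_str iota (fsum (c : mulmon k)) = assocOBelt iota c 1%g.
  exact: assoc_str_funE.
have eT : absval_hom hv (fsum (c : mulmon k)) = tropelt (v c).
  exact: absval_funE.
by rewrite -eB -eT.
Qed.

Lemma assoc_trop_scal (c : k) (a : A) (t : {nonneg T}) :
  i (assocOBelt iota c a) * j (tropelt t) =
  i (assocOBelt iota 1 a) * j (tropelt ((v c)%:num * t%:num)%:nng).
Proof. by rewrite assoc_hom_scal trop_homM -mulrA mulrCA. Qed.

(** By [trop_homD] the map [j] is additive for the maximum on scalars, so it extends with [i] to the
    monoid semiring. A bend relation [x + y ~ y] holds in [E] because it is the image of a
    generating inequality [x <= y] of [B]. *)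
Lemma bend_univ :
  {G : obHom (bend v iota) E | forall t a,
    G (bcls t a) = i (assocOBelt iota 1 a) * j (tropelt t)}.
Proof.
pose s (t : tropsf T) : E := j (tropelt t).
pose m1 := GRing.isNmodMorphism.Build _ _ s (conj trop_hom0 trop_homD).
pose m2 := GRing.isMonoidMorphism.Build _ _ s (conj trop_hom1 trop_homM).
pose S : {rmorphism tropsf T -> E} := HB.pack s m1 m2.
pose u a := i (assocOBelt iota 1 a).
have u1 : u 1%g = 1 by exact: (rmorph1 i).
have uM a b : u (a * b)%g = u a * u b.
  by rewrite /u -[in LHS](mulr1 1) assocOBeltM rmorphM.
have [G GE] := @monsr_lift _ _ _ S u u1 uM.
have GvE c a : G (tmono (v c) a) = i (assocOBelt iota c a).
  by rewrite GE assoc_hom_scal.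
have Gr x y : gencong (bend_rel v iota) x y -> G x = G y.
  elim=> {x y} [_ _ [c [a [l [e -> ->]]]]|x|x y _ ->|x y w _ -> _ ->|x y w _ xy
    |x y w _ xy] //.
  - rewrite rmorphD rmorph_sum GvE.
    under eq_bigr do rewrite GvE.
    rewrite -rmorph_sum; apply/trop_hom_leE; apply: hom_le; apply: genpre_in.
    exists c, a, l; split=> //.
    by move/eqP: e; rewrite rmorphB rmorph_sum subr_eq0 => /eqP.
  - by rewrite !rmorphD xy.
  - by rewrite !rmorphM xy.
have [H HE] := @cquot_lift _ (gen_congruence (bend_rel v iota)) _ G Gr.
have {}HE t a : H (bcls t a) = i (assocOBelt iota 1 a) * j (tropelt t).
  by rewrite [H _]HE GE mulrC.
have Hmon (x : bend v iota) : bmon x -> bmon (H x).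
  move=> [t [a ->]]; rewrite HE; apply: bmonM; apply: hom_mon.
    by exists (assocelt iota 1 a).
  by exists t.
have Hle (x y : bend v iota) : ble x y -> ble (H x) (H y).
  by move=> ->; exact: ble_refl.
by exists (@ObHom (bend v iota) E H Hmon Hle).
Qed.

End BendUniversal.

(** * The inverse map and the underlying monoid of the idempotent tropicalization *)

Local Notation P := (ob_idem BT).

Lemma idem_trop_idem : 1 + 1 = 1 :> P.
Proof.
rewrite -(rmorph1 (idem_cls BT)) -rmorphD; apply/pclsP.
by split; apply: genpre_in; right; [left | right].
Qed.

Definition idem_inl : obHom (assocOB iota) P :=
  ob_comp (idem_cls BT) (tensor_inl (assoc_str iota) (absval_hom hv)).
Definition idem_inr : obHom (trop T) P :=
  ob_comp (idem_cls BT) (tensor_inr (assoc_str iota) (absval_hom hv)).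

Lemma idem_inlr b : idem_inl (assoc_str iota b) = idem_inr (absval_hom hv b).
Proof.
have [bal _] := tensor_pushout (assoc_str iota) (absval_hom hv).
exact: (congr1 (idem_cls BT) (bal b)).
Qed.

Lemma idem_eltE c a t :
  idem_cls BT (elt c a t) = idem_inl (assocOBelt iota c a) * idem_inr (tropelt t).
Proof. exact: (rmorphM (idem_cls BT)). Qed.

Lemma bend_tensor :
  {G : obHom (bend v iota) P | forall t a,
    G (bcls t a) = idem_cls BT (elt 1 a t)}.
Proof.
have [G GE] := bend_univ idem_inlr idem_trop_idem.
by exists G => t a; apply: (etrans (GE t a)); symmetry; exact: idem_eltE.
Qed.

Lemma idem_trop_le01 : ble (0 : P) 1.
Proof. exact: (trop_hom_le01 idem_inr idem_trop_idem). Qed.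

Lemma idem_trop_scal c a t :
  idem_cls BT (elt c a t) = idem_cls BT (elt 1 a ((v c)%:num * t%:num)%:nng).
Proof.
apply: (etrans (idem_eltE c a t)).
apply: (etrans (assoc_trop_scal idem_inlr c a t)).
by symmetry; exact: idem_eltE.
Qed.

(** Such an element is the class of a pure tensor [iota(c a) (x) t]; moving [c] to the right factor
    as [v(c)] leaves coefficient [1], which puts it in the image of [bend_tensor]. *)
Lemma idem_trop_mon (x : P) : bmon x ->
  exists t a, x = idem_cls BT (elt 1 a t).
Proof.
move=> [_ [_ [_ [[m ->] [t ->] ->]]] ->]; have [c [a ->]] := assocmonP m.
exists ((v c)%:num * t%:num)%:nng, a.
apply: etrans (idem_trop_scal c a t); apply: (congr1 (idem_cls BT)).
apply: etrans (tensM _ _ (assocOBelt iota c a) 1 1 (tropelt t)).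
by rewrite mulr1 mul1r.
Qed.

End TropToBend.

Theorem theorem5p6 (T : realType) (k : fieldType) (v : k -> {nonneg T})
    (hv : nonarch_absval v) (A : comMonoidType)
    (R : comPzRingType) (kR : {rmorphism k -> R})
    (iota : {rmorphism monsr k A -> R})
    (iota_lin : forall c : k, iota (mono c 1%g) = kR c)
    (iota_surj : forall x : R, exists f : monsr k A, iota f = x) :
  let Y := Spec (assocOB iota) in
  let TropY := Trop hv (Y := Y) (assoc_str iota) in
  let BendX := Spec (bend v iota) in
  exists (Phi : affHom (aff_pos BendX) (aff_idem TropY))
         (Psi : affHom BendX (aff_core (aff_idem TropY))),
    [/\ aff_iso Phi,
        aff_iso Psi,
        forall (c : k) (a : A) (t : {nonneg T}),
          Phi (idem_cls (coordOB TropY)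
                 (trop_elt hv (Y := Y) (assoc_str iota)
                    (assocOBelt iota c a) t)) =
          pos_cls (coordOB BendX) (bend_cls v iota ((v c)%:num * t%:num)%:nng a) &
        forall (c : k) (a : A) (t : {nonneg T}),
          Psi (idem_cls (coordOB TropY)
                 (trop_elt hv (Y := Y) (assoc_str iota)
                    (assocOBelt iota c a) t)) =
          bend_cls v iota ((v c)%:num * t%:num)%:nng a].

Proof.
move=> Y TropY BendX.
have [F FE] := tensor_bend hv iota; have [G GE] := bend_tensor hv iota.
have FG t a : F (G (bend_cls v iota t a)) = bend_cls v iota t a.
  (* [G] uses coefficient [1] in [k], so the scalar returns as [v(1) t = t]. *)
  rewrite GE FE; congr bend_cls; apply: val_inj.
  by rewrite /= (absval1 hv) mul1r.
have FG' x : bmon x -> F (G x) = x by case=> t [a ->].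
have GF x : bmon x -> G (F x) = x.
  move=> /idem_trop_mon[t [a ->]]; rewrite FE -GE; congr (G (bend_cls _ _ _ _)).
  by apply: val_inj; rewrite /= (absval1 hv) mul1r.
have trivB (x y : bend v iota) : ble x y -> x = y by [].
(* Morphisms of spectra reverse those of blueprints, so [F], which goes into the bend, induces both
   required maps. *)
have [Phi [Psi [iPhi iPsi PhiE PsiE]]] :=
  natob_iso trivB (idem_trop_le01 hv iota) FG' GF.
exists Phi, Psi; split=> // c a t.
  by apply: (etrans (PhiE _)); apply: congr1 (FE c a t).
exact: (etrans (PsiE (idem_cls _ _)) (FE c a t)).
Qed.
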